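(* Let $I=[0,1]$, $\mathbb{R}^+=[0,\infty)$, and consider the system $$x_j(t)=\int_0^1G_j(t,s)f_j(s,x_1(s),x_2(s))\,ds,\quad t\in I,\quad j=1,2. \qquad (\ast)$$ Assume that for each $j\in\{1,2\}$: the kernel $G_j:I^2\to\mathbb{R}^+$ is continuous; there exist a closed interval $J\subset I$ (the same for $j=1,2$), a function $\Phi_j:I\to\mathbb{R}^+$ with $\Phi_j\in L^1(0,1)$ and $\int_J\Phi_j(s)\,ds>0$, and a constant $c_j\in(0,1)$ such that $G_j(t,s)\leq\Phi_j(s)$ for all $t,s\in I$ and $c_j\Phi_j(s)\leq G_j(t,s)$ for all $t\in J$, $s\in I$; and the function $f_j:I\times\mathbb{R}^+\times\mathbb{R}^+\to\mathbb{R}^+$ is continuous. Suppose that there exist $r_j,R_j,A_j,B_j\in(0,\infty)$, $j=1,2$, such that $\frac{2}{c_j+1}r_j<R_j$, $B_j\leq d_j\leq A_j$ and $B_jS_j+A_jS_j^c<1$. Assume further that, for each $j\in\{1,2\}$: (A) $0\leq M_j^{R}(s)\leq A_jR_j$ for $s\in J^c$ and $0\leq M_j^{\frac{2c}{c+1}r,R}(s)\leq B_jR_j$ for $s\in J$; (B) $\breve{m}_j^{r,R}(s)>D_jr_j$ for $s\in J$. Then the system $(\ast)$ has at least one positive solution $(x_1,x_2)\in K$ such that $\phi_j(x_j)>r_j$ and $\|x_j\|_\infty<R_j$ for $j=1,2$.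
   Context: Here $J^c=I\setminus J$, $\|x\|_\infty=\max_{t\in I}|x(t)|$, and $$d_j:=\left(\max_{t\in[0,1]}\int_0^1G_j(t,s)ds\right)^{-1},\qquad D_j:=\left(\min_{t\in J}\int_JG_j(t,s)ds\right)^{-1},$$ $$S_j:=\max_{t\in[0,1]}\int_JG_j(t,s)ds,\qquad S_j^c:=\max_{t\in[0,1]}\int_{J^c}G_j(t,s)ds.$$ The cone is $K=K_1\times K_2$ with $$K_j=\{x\in\mathcal{C}(I):x(t)\geq0\text{ for }t\in I,\ x(t)\geq c_j\|x\|_\infty\text{ for }t\in J\},$$ and $\phi_j:K_j\to\mathbb{R}^+$ is the functional $\phi_j(x)=\frac12\left(\min_{t\in J}x(t)+\|x\|_\infty\right)$. For $s\in I$, $j\in\{1,2\}$ and $i\in\{1,2\}$, $i\neq j$: $$M_j^{R}(s):=\max\{f_j(s,x_1,x_2):0\leq x_j\leq R_j,\ 0\leq x_i\leq R_i\},$$ $$M_j^{\frac{2c}{c+1}r,R}(s):=\max\left\{f_j(s,x_1,x_2):c_jR_j\leq x_j\leq R_j,\ \tfrac{2c_i}{c_i+1}r_i\leq x_i\leq R_i\right\},$$ $$\breve{m}_j^{r,R}(s):=\min\left\{f_j(s,x_1,x_2):\tfrac{2c_j}{c_j+1}r_j\leq x_j\leq\tfrac{2}{c_j+1}r_j,\ \tfrac{2c_i}{c_i+1}r_i\leq x_i\leq R_i\right\}.$$ A positive solution is a pair of nonnegative, not identically zero, continuous functions on $I$ satisfying the system. *)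

(* Defs.v *)
From mathcomp Require Import all_boot all_order all_algebra.
From mathcomp Require Import all_classical all_reals all_analysis.

Set Implicit Arguments.
Unset Strict Implicit.
Unset Printing Implicit Defensive.

Import Order.TTheory GRing.Theory Num.Theory.
Import numFieldNormedType.Exports.

Local Open Scope classical_set_scope.
Local Open Scope ring_scope.

(* Conventions.
   - The index set {1, 2} is 'I_2, whose elements are 0 and 1.
   - Functions on [0, 1], [0, 1]^2 or [0, 1] * [0, +oo[ ^2 are total functions
     on R of which only the values on these domains are constrained and used.
   - max and min are rendered by sup and inf. Under the standing assumptions
     they are only taken of continuous real functions over nonempty compact
     sets, so they are attained. *)

Section Definitions.
Context {R : realType}.
Implicit Types (J : set R) (G : R -> R -> R) (x : R -> R).
Implicit Types (f : 'I_2 -> R -> R -> R -> R) (c r Rad : 'I_2 -> R).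

Definition unitI : set R := `[0, 1].

Definition const_d G : R :=
  (sup [set \int[lebesgue_measure]_(s in unitI) G t s | t in unitI])^-1.

Definition const_D J G : R :=
  (inf [set \int[lebesgue_measure]_(s in J) G t s | t in J])^-1.

Definition const_S J G : R :=
  sup [set \int[lebesgue_measure]_(s in J) G t s | t in unitI].

Definition const_Sc J G : R :=
  sup [set \int[lebesgue_measure]_(s in unitI `\` J) G t s | t in unitI].

(* The measure is the completed one because Phi is only Lebesgue (not
   necessarily Borel) measurable; the other integrands in this file are
   continuous, and their Lebesgue integrals are the same for both measures. *)
Definition kernel_bound J G (Phi : R -> R) (cj : R) : Prop :=
  [/\ forall s, unitI s -> 0 <= Phi s,
      completed_lebesgue_measure.-integrable `]0, 1[ (EFin \o Phi),
      0 < \int[completed_lebesgue_measure]_(s in J) Phi s,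
      forall t s, unitI t -> unitI s -> G t s <= Phi s &
      forall t s, J t -> unitI s -> cj * Phi s <= G t s].

Definition norm_inf x : R := sup [set `|x t| | t in unitI].

Definition cone J (cj : R) : set (R -> R) :=
  [set x : R -> R | [/\ {within unitI, continuous x},
               forall t, unitI t -> 0 <= x t &
               forall t, J t -> cj * norm_inf x <= x t]].

Definition cone_prod J c : set ('I_2 -> R -> R) :=
  [set x | forall j, cone J (c j) (x j)].

Definition phi J x : R := 2^-1 * (inf [set x t | t in J] + norm_inf x).

Definition box (lo hi : 'I_2 -> R) : set ('I_2 -> R) :=
  [set y | forall i, lo i <= y i <= hi i].

Definition M_R f Rad (j : 'I_2) (s : R) : R :=
  sup [set f j s (y 0) (y 1) | y in box (fun=> 0) Rad].

Definition M_rR f c r Rad (j : 'I_2) (s : R) : R :=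
  sup [set f j s (y 0) (y 1) | y in
    box (fun i => if i == j then c j * Rad j else 2 * c i / (c i + 1) * r i)
        Rad].

Definition m_rR f c r Rad (j : 'I_2) (s : R) : R :=
  inf [set f j s (y 0) (y 1) | y in
    box (fun i => 2 * c i / (c i + 1) * r i)
        (fun i => if i == j then 2 / (c j + 1) * r j else Rad i)].

Definition positive_solution (G : 'I_2 -> R -> R -> R) f (x : 'I_2 -> R -> R)
    : Prop :=
  forall j,
  [/\ {within unitI, continuous (x j)},
      forall t, unitI t -> 0 <= x j t,
      exists2 t, unitI t & x j t != 0 &
      forall t, unitI t ->
        x j t = \int[lebesgue_measure]_(s in unitI)
                  (G j t s * f j s (x 0 s) (x 1 s))].

End Definitions.

(* Main.v *)
Require Import Defs.
From mathcomp Require Import all_boot all_order all_algebra.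
From mathcomp Require Import zify ring lra.

(** A fixed point is found first for a truncated system, to which
    Schauder's theorem applies directly, and conditions (A) and (B) then show
    that the truncation is inactive at this fixed point.

    Put [lo i = 2 c_i r_i / (c_i + 1)].  In the integral over [J] every
    argument [x_i] of [f_j] is truncated to [[lo i, Rad i]], in the integral
    over the complement of [J] it is truncated to [[0, Rad i]].  The resulting
    operator is defined on all pairs of continuous functions, has bounded and
    equicontinuous values, and all its values lie in the cone; it has a fixed
    point [x] by [truncated_op_fixed].  For such an [x]:
    - if [norm_inf (x j) >= Rad j], then [x j >= c j * Rad j] on [J] by the
      cone condition, so that (A) bounds the truncated nonlinearity by
      [B j * Rad j] on [J] and by [A j * Rad j] elsewhere, whence
      [x j <= (B j * const_S + A j * const_Sc) * Rad j < Rad j], a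
      contradiction;
    - if [phi J (x j) <= r j], then [x j <= 2 r_j / (c_j + 1)] by
      [cone_mean_le], so that the truncated arguments lie in the box of (B);
      integrating [f_j > const_D * r j] over [J] gives [x j > r j] on [J],
      hence [phi J (x j) > r j], a contradiction;
    - finally [phi J (x j) > r j] forces [x j >= lo j] on [J]
      ([cone_mean_gt]).
    So [x] solves the original system, with both strict inequalities.

    Schauder's theorem ([schauder_curves]) is reduced to finite dimension by
    recording a curve by its values at the nodes of a mesh, which yields curves
    moved by at most [e] for every [e > 0] ([approx_fixed_curve]); by
    equicontinuity their images converge uniformly along an ultrafilter, to a
    fixed point.  In finite dimension only approximate fixed points are needed
    ([approx_brouwer]).  They come from a purely combinatorial statement about
    a colouring of a finite set carrying several linear orders ([scarf]),
    obtained by counting incidences modulo 2, and applied here to the integer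
    points of a dilated simplex ordered by their coordinates. *)

Set Implicit Arguments.
Unset Strict Implicit.
Unset Printing Implicit Defensive.

(** * Dominant sets of a family of linear orders *)

Section Dominance.
Variables (I T : finType) (rk : I -> T -> nat).
Hypothesis rk_inj : forall i, injective (rk i).

(** No point of [T] exceeds the minimum of [P] in every order at once. *)
Definition dominant (P : {set T}) : bool :=
  [forall x, exists i, [forall y in P, rk i x <= rk i y]].

Lemma dominantP (P : {set T}) :
  reflect (forall x, exists i, forall y, y \in P -> rk i x <= rk i y)
          (dominant P).
Proof.
apply: (iffP forallP) => H x.
  by have /existsP[i /forallP Hi] := H x; exists i => y yP; apply: (implyP (Hi y)).
by have [i Hi] := H x; apply/existsP; exists i; apply/forallP => y; apply/implyP/Hi.
Qed.

Lemma dominantS (P Q : {set T}) : Q \subset P -> dominant P -> dominant Q.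
Proof.
move=> /subsetP sQP /dominantP dP; apply/dominantP => x.
by have [i Hi] := dP x; exists i => y /sQP; apply: Hi.
Qed.

(** For a nonempty dominant [Q], [mn i] is the least element of [Q] in the order
    [i].  Dominance makes [mn] surjective onto [Q], since a point of [Q] can only
    lie below [Q] by being its minimum.  Sets with one element less than there
    are orders (doors) therefore have exactly one pair [i], [j] of orders with a
    common minimum. *)
Section Door.
Variables (Q : {set T}) (mn : I -> T).
Hypothesis mn_in : forall i, mn i \in Q.
Hypothesis mn_min : forall i y, y \in Q -> rk i (mn i) <= rk i y.
Hypothesis domQ : dominant Q.

Lemma mn_uniq i x : x \in Q -> (forall y, y \in Q -> rk i x <= rk i y) -> mn i = x.
Proof.
by move=> xQ H; apply: (@rk_inj i); apply/eqP; rewrite eqn_leq mn_min //= H.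
Qed.

Lemma mn_onto x : x \in Q -> exists i, mn i = x.
Proof.
by move=> xQ; have /dominantP/(_ x)[i Hi] := domQ; exists i; apply: mn_uniq.
Qed.

Definition beats (i : I) : {set T} := [set x | [forall (k | k != i), rk k (mn k) < rk k x]].

Lemma beatsP i x :
  reflect (forall k, k != i -> rk k (mn k) < rk k x) (x \in beats i).
Proof. by rewrite inE; apply: (iffP forall_inP). Qed.

Lemma beats_lt i x : x \in beats i -> rk i x <= rk i (mn i).
Proof.
move=> /beatsP xb; have /dominantP/(_ x)[k Hk] := domQ.
have [<-|/xb] := eqVneq k i; first exact: Hk.
by rewrite ltnNge Hk.
Qed.

Variables i j : I.
Hypothesis neq_ij : i != j.
Hypothesis eq_mn : mn i = mn j.
Hypothesis mn_inj : {in [set~ i] &, injective mn}.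

Lemma mn_onto1 x : x \in Q -> exists2 k, k != i & mn k = x.
Proof.
move=> /mn_onto[k <-]; have [->|ki] := eqVneq k i; last by exists k.
by exists j => //; rewrite eq_sym.
Qed.

Lemma beats_notin x : x \in beats i -> x \notin Q.
Proof.
move=> /beatsP xb; apply/negP => /mn_onto1[k ki kx].
by have := xb _ ki; rewrite kx ltnn.
Qed.

Definition top_of (A : {set T}) x := (x \in A) && [forall y in A, rk i y <= rk i x].

(** A point added to [Q] must take over the role of minimum from one of the two
    orders [i], [j] that share it, say from [i]; it has to stay above the old
    minima of all other orders, and to be the largest such point for [i], since
    a larger one would beat the enlarged set in every order. *)
Lemma top_room x :
  top_of (beats i) x =
  [&& x \notin Q, dominant (x |: Q) & rk i x <= rk i (mn i)].
Proof.
apply/andP/and3P.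
  move=> [xb /forall_inP xtop]; split; [exact: beats_notin| |exact: beats_lt].
  apply/dominantP => y; have [yb|] := boolP (y \in beats i).
    exists i => z /setU1P[->|zQ]; first exact: xtop.
    apply: leq_trans (xtop _ yb) _; apply: leq_trans (beats_lt xb) _.
    exact: mn_min.
  rewrite inE negb_forall_in => /exists_inP[k ki]; rewrite -leqNgt => yk.
  exists k => z /setU1P[->|zQ]; last exact: leq_trans yk (mn_min _ zQ).
  by apply: leq_trans yk (ltnW _); move/beatsP: xb; apply.
move=> [xQ /dominantP domP xi].
have lt_of k y : y \in Q -> rk k y <= rk k x -> rk k y < rk k x.
  move=> yQ yx; rewrite ltn_neqAle yx andbT; apply: contraNneq xQ => /rk_inj.
  by move=> <-.
have xb : x \in beats i.
  apply/beatsP => k ki; apply: lt_of => //.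
  have [l Hl] := domP (mn k).
  have lx : rk l (mn k) <= rk l x by apply: Hl; rewrite setU11.
  have mnl : mn l = mn k.
    by apply: mn_uniq => // y yQ; apply: Hl; rewrite setU1r.
  have li : l != i.
    apply: contraTneq lx => li; rewrite -mnl li -ltnNge ltn_neqAle xi andbT.
    by apply: contraNneq xQ => /rk_inj ->.
  by rewrite -(mn_inj _ _ mnl) ?mnl // !inE.
split=> //; apply/forall_inP => y yb; have [k Hk] := domP y.
have [<-|ki] := eqVneq k i; first by apply: Hk; rewrite setU11.
move/beatsP: yb => /(_ k ki); rewrite ltnNge Hk //.
by rewrite setU1r.
Qed.

End Door.

Lemma card_top i (A : {set T}) : #|[set x | top_of i A x]| = (A != set0).
Proof.
have [->|/set0Pn[x0 x0A]] := eqVneq A set0.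
  by apply/eqP; rewrite cards_eq0 -subset0; apply/subsetP => x; rewrite !inE /top_of !inE.
case: (arg_maxnP (rk i) x0A) => x xA xmax; apply/eqP/cards1P; exists x.
apply/setP => y; rewrite !inE; apply/andP/eqP => [[yA /forall_inP ytop]|->].
  by apply: (@rk_inj i); apply/eqP; rewrite eqn_leq ytop // andbT; apply: xmax.
by split=> //; apply/forall_inP => z /xmax.
Qed.

(** The dominant sets obtained by adding a point to [Q] are represented by that
    point. *)
Definition rooms (Q : {set T}) := [set x | (x \notin Q) && dominant (x |: Q)].

Lemma door_pair (Q : {set T}) : dominant Q -> Q != set0 -> #|Q|.+1 = #|I| ->
  exists mn i j,
   [/\ forall k, mn k \in Q,
       forall k y, y \in Q -> rk k (mn k) <= rk k y,
       i != j, mn i = mn j &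
       {in [set~ i] &, injective mn} /\ {in [set~ j] &, injective mn}].
Proof.
move=> domQ /set0Pn[y0 y0Q] cardQ.
pose mn k := [arg min_(y < y0 in Q) rk k y].
have mn_in k : mn k \in Q by rewrite /mn; case: arg_minnP.
have mn_min k y : y \in Q -> rk k (mn k) <= rk k y.
  by rewrite /mn; case: arg_minnP => // z zQ zmin; apply: zmin.
have : ~~ injectiveb mn.
  apply/negP => /injectiveP mn_inj.
  have : #|[set mn k | k in I]| <= #|Q|.
    by apply/subset_leq_card/subsetP => _ /imsetP[k _ ->].
  by rewrite card_imset // -cardQ ltnn.
move=> /injectivePn[i [j]]; rewrite eq_sym => neq_ji eq_mn; have neq_ij: i != j by rewrite eq_sym.
have inj1 (p q : I) : p != q -> mn p = mn q -> {in [set~ p] &, injective mn}.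
  move=> neq_pq eq_pq; apply/imset_injP/eqP.
  suff -> : mn @: [set~ p] = Q by rewrite cardsC1 -cardQ.
  apply/setP => x; apply/imsetP/idP => [[k _ ->]|/(mn_onto mn_in mn_min domQ)[k <-]] //.
  have [->|kp] := eqVneq k p; last by exists k; rewrite // !inE.
  by exists q; rewrite // !inE eq_sym.
exists mn, i, j; split=> //; split; first exact: (inj1 i j).
exact: (inj1 j i).
Qed.

(** By [top_room] every enlargement comes from [i] or from [j], and it cannot
    come from both since it would beat [Q]; each of the two orders contributes
    one enlargement, unless nothing beats [Q] in the other orders. *)
Lemma card_rooms (Q : {set T}) (mn : I -> T) i j :
  dominant Q ->
  (forall k, mn k \in Q) ->
  (forall k y, y \in Q -> rk k (mn k) <= rk k y) ->
  i != j -> mn i = mn j ->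
  {in [set~ i] &, injective mn} -> {in [set~ j] &, injective mn} ->
  #|rooms Q| = (beats mn i != set0) + (beats mn j != set0).
Proof.
move=> domQ mn_in mn_min neq_ij eq_mn inji injj.
have neq_ji : j != i by rewrite eq_sym.
rewrite -(card_top i) -(card_top j) -cardsUI.
rewrite [X in _ + #|pred_of_set X|](_ : _ = set0) ?cards0 ?addn0; last first.
  apply/setP => x; rewrite !inE; apply/negbTE/negP => /andP[/andP[/beatsP xi _] /andP[/beatsP xj _]].
  have /dominantP/(_ x)[k Hk] := domQ; have := Hk _ (mn_in k).
  rewrite leqNgt; have [ki|ki] := eqVneq k i; last by rewrite xi.
  by rewrite xj // ki.
congr #|pred_of_set _|; apply/setP => x; rewrite !inE.
rewrite (top_room mn_in mn_min domQ neq_ij eq_mn inji).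
rewrite (top_room mn_in mn_min domQ neq_ji (esym eq_mn) injj).
rewrite -!andb_orr; case: (boolP (x \notin Q)) => //= xQ.
case: (boolP (dominant (x |: Q))) => //= domP; apply/esym.
have /dominantP/(_ x)[k Hk] := domP.
have xmn : rk k x <= rk k (mn k) by apply: Hk; rewrite setU1r.
have [<-|ki] := eqVneq k i; first by rewrite xmn.
have [<-|kj] := eqVneq k j; first by rewrite xmn orbT.
exfalso; have /dominantP/(_ (mn k))[l Hl] := domP.
have mnl : mn l = mn k by apply: (mn_uniq mn_in mn_min) => // y yQ; apply: Hl; rewrite setU1r.
have lk : l != k.
  apply: contraNneq xQ => lk; suff -> : x = mn k by [].
  apply: (@rk_inj k); apply/eqP; rewrite eqn_leq xmn /=.
  by have := Hl x (setU11 _ _); rewrite lk.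
have [li|li] := eqVneq l i; last first.
  by move/eqP: lk; apply; apply: inji; rewrite ?inE.
move/eqP: lk; apply; apply: injj; rewrite ?inE //.
by rewrite li.
Qed.

Section Parity.
Variables (col : T -> I) (i0 : I).

(** Doors that carry every colour except [i0], each exactly once. *)
Definition almost_colorful (Q : {set T}) := (#|Q|.+1 == #|I|) && (col @: Q == [set~ i0]).

(** Both sides count the pairs made of an almost colourful door and a dominant
    set that extends it by one point. *)
Lemma door_room_count :
  \sum_(Q | almost_colorful Q) #|rooms Q| =
  \sum_(P | dominant P) #|[set x in P | almost_colorful (P :\ x)]|.
Proof.
transitivity (\sum_(Q | almost_colorful Q) \sum_(x : T) ((x \notin Q) && dominant (x |: Q) : nat)).
  by apply: eq_bigr => Q _; rewrite -sum1dep_card big_mkcond; apply: eq_bigr => x _; case: ifP.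
rewrite exchange_big /=.
transitivity (\sum_(x : T) \sum_(P | dominant P) ((x \in P) && almost_colorful (P :\ x) : nat)); last first.
  rewrite exchange_big /=; apply: eq_bigr => P _.
  by rewrite -sum1dep_card [RHS]big_mkcond; apply: eq_bigr => x _; case: ifP.
apply: eq_bigr => x _.
transitivity (\sum_(Q | almost_colorful Q && (x \notin Q)) (dominant (x |: Q) : nat)).
  by rewrite [RHS]big_mkcondr; apply: eq_bigr => Q _; case: (x \notin Q).
rewrite (reindex_onto (fun P => P :\ x) (fun Q => x |: Q)) /=; last first.
  by move=> Q /andP[_ xQ]; rewrite setU1K.
rewrite big_mkcond [RHS]big_mkcond; apply: eq_bigr => P _.
rewrite setD11 andbT; have [xP|xP] := boolP (x \in P).
  by rewrite setD1K // eqxx andbT /=; case: almost_colorful; case: dominant.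
case: eqP => [eqP|_]; first by rewrite -eqP setU11 in xP.
by rewrite andbF; case: dominant.
Qed.

(** If removing [x] leaves an almost colourful door and [P] does not have all
    colours, then the colour of [x] occurs a second time, at a unique [y], and
    removing [y] instead is the only other possibility. *)
Lemma even_colorful_faces (P : {set T}) : col @: P != [set: I] ->
  ~~ odd #|[set x in P | almost_colorful (P :\ x)]|.
Proof.
move=> colP; set Y := [set x in P | _].
have [->|/set0Pn[x xY]] := eqVneq Y set0; first by rewrite cards0.
have := xY; rewrite inE => /and3P[xP /eqP cardPx /eqP colPx].
have colx : col x \in [set~ i0].
  rewrite !inE; apply: contraNneq colP => colx; apply/eqP/setP => i; rewrite inE.
  have [->|ii0] := eqVneq i i0; first by rewrite -colx imset_f.
  have : i \in col @: (P :\ x) by rewrite colPx !inE.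
  by move=> /imsetP[y]; rewrite !inE => /andP[_ yP] ->; rewrite imset_f.
have injPx : {in P :\ x &, injective col}.
  by apply/imset_injP; rewrite colPx cardsC1 -cardPx.
have := colx; rewrite -colPx => /imsetP[y yPx colxy].
have := yPx; rewrite !inE => /andP[yx yP].
suff -> : Y = [set x; y] by rewrite cards2 eq_sym yx.
apply/setP => z; rewrite !inE; apply/idP/idP; last first.
  move=> /orP[/eqP ->|/eqP ->]; first by have := xY; rewrite inE.
  rewrite yP /almost_colorful.
  have -> : #|P :\ y| = #|P :\ x|.
    by apply/eqP; rewrite -eqSS; have := cardsD1 x P; rewrite (cardsD1 y P) xP yP !add1n => ->.
  rewrite cardPx eqxx -colPx; apply/eqP/setP => i; apply/imsetP/imsetP.
    move=> [w]; rewrite !inE => /andP[wy wP] ->.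
    have [->|wx] := eqVneq w x; [exists y | exists w]; rewrite // !inE ?yx ?wx ?wP //.
  move=> [w]; rewrite !inE => /andP[wx wP] ->.
  have [->|wy] := eqVneq w y; [exists x | exists w]; rewrite // !inE ?wy ?wP ?xP ?andbT //.
  by rewrite eq_sym yx.
move=> /and3P[zP _ /eqP colPz]; apply/norP => -[zx zy].
have : col z \in [set~ i0] by rewrite -colPx imset_f // !inE zx.
rewrite -colPz => /imsetP[w]; rewrite !inE => /andP[wz wP] colzw.
have [wx|wx] := eqVneq w x.
  case/eqP: zy; apply: injPx => //; first by rewrite !inE zx.
  by rewrite colzw wx.
by case/eqP: wz; apply: injPx => //; rewrite !inE ?zx ?wx.
Qed.

(** Counting modulo 2: the left side of [door_room_count] is odd because [Q0] is
    the only odd door, so some dominant set on the right contributes an odd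
    number, which [even_colorful_faces] excludes for sets missing a colour. *)
Lemma colorful_room (Q0 : {set T}) :
  almost_colorful Q0 -> odd #|rooms Q0| ->
  (forall Q, almost_colorful Q -> dominant Q -> Q != Q0 -> ~~ odd #|rooms Q|) ->
  exists2 P, dominant P & col @: P = [set: I].
Proof.
move=> aQ0 odd0 evenQ.
have even_sum (A : pred {set T}) (F : {set T} -> nat) :
    (forall Q, A Q -> ~~ odd (F Q)) -> ~~ odd (\sum_(Q | A Q) F Q).
  move=> H; apply: (big_ind (fun n => ~~ odd n)) => // m n.
  by rewrite oddD; case: odd; case: odd.
have : odd (\sum_(Q | almost_colorful Q) #|rooms Q|).
  rewrite (bigD1 Q0) //= oddD odd0 /=; apply: even_sum => Q /andP[aQ QQ0].
  have [dQ|dQ] := boolP (dominant Q); first exact: evenQ.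
  suff -> : rooms Q = set0 by rewrite cards0.
  apply/setP => x; rewrite !inE; apply: contraNF dQ => /andP[_].
  by apply: dominantS; apply: subsetU1.
rewrite door_room_count => oddS.
have [/existsP[P /andP[domP /eqP colP]]|] :=
  boolP [exists P : {set T}, dominant P && (col @: P == [set: I])].
  by exists P.
rewrite negb_exists => /forallP noP; suff : false by [].
move: oddS; apply: contraLR => _; apply: even_sum => P domP.
by apply: even_colorful_faces; have := noP P; rewrite domP.
Qed.

End Parity.
End Dominance.

(** Every order [i] gets a slack point [inr i], the minimum of that order and
    larger than all genuine points in the other orders.  The slack points in a
    dominant set mark the orders that the genuine points leave unused, so that
    sets with fewer elements than there are orders need no separate treatment,
    and the only exceptional door is the one that consists of all slack points
    but [inr i0]. *)
Section Scarf.
Variables (I T : finType) (rk : I -> T -> nat) (col : T -> I).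
Hypothesis rk_inj : forall i, injective (rk i).

Let bound := (\max_(p : I * T) rk p.1 p.2).+2.

Definition rank_slack (i : I) (z : T + I) : nat :=
  match z with
  | inl x => (rk i x).+1
  | inr k => if k == i then 0 else bound + enum_rank k
  end.

Definition col_slack (z : T + I) : I := match z with inl x => col x | inr k => k end.

Lemma rank_slack_lt i k x : k != i -> rank_slack i (inl x) < rank_slack i (inr k).
Proof.
move=> /negbTE /= ->; rewrite /bound !addSn !ltnS; apply: leq_trans (leq_addr _ _).
exact: (leq_bigmax (i, x)).
Qed.

Lemma rank_slack_inj i : injective (rank_slack i).
Proof.
have lt := @rank_slack_lt i.
move=> [x|k] [y|l] eq_r.
- by case: eq_r => /rk_inj ->.
- have [li|li] := eqVneq l i; first by move: eq_r; rewrite /= li eqxx.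
  by have := lt l x li; rewrite eq_r ltnn.
- have [ki|ki] := eqVneq k i; first by move: eq_r; rewrite /= ki eqxx.
  by have := lt k y ki; rewrite eq_r ltnn.
move: eq_r => /=; case: eqP => [->|_]; case: eqP => [->|_] //.
by move=> /addnI /ord_inj /enum_rank_inj ->.
Qed.

(** A form of Scarf's lemma.  The set [C] collects the orders whose slack point
    is missing from a colourful dominant set. *)
Lemma scarf (x0 : T) : 1 < #|I| ->
  exists (s : {set T}) (C : {set I}),
    [/\ C != set0, forall i, i \in C -> exists2 y, y \in s & col y = i &
        forall x, exists2 i, i \in C & forall y, y \in s -> rk i x <= rk i y].
Proof.
move=> I2; have /card_gt0P[i0 _] : 0 < #|I| by apply: ltnW.
pose Q0 : {set T + I} := [set inr k | k in [set~ i0]].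
have inrQ0 k : (inr k \in Q0) = (k != i0).
  by rewrite mem_imset ?inE // => a b [].
have inlQ0 x : (inl x \in Q0) = false by apply/negP => /imsetP[].
have cardQ0 : #|Q0|.+1 = #|I|.
  by rewrite card_imset ?cardsC1 ?prednK // => [|a b []]; rewrite // ltnW.
have aQ0 : almost_colorful col_slack i0 Q0.
  rewrite /almost_colorful cardQ0 eqxx -imset_comp; apply/eqP/setP => k.
  by rewrite (eq_imset (g := id)) ?imset_id.
have domQ0 : dominant rank_slack Q0.
  apply/dominantP => -[x|k].
    exists i0 => -[y|k]; rewrite ?inlQ0 ?inrQ0 // => ki0.
    by apply/ltnW/rank_slack_lt.
  by exists k => y _; rewrite /= eqxx.
have ne0 (Q : {set T + I}) : #|Q|.+1 = #|I| -> Q != set0.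
  by move=> cQ; apply/negP => /eqP Q0'; move: I2; rewrite -cQ Q0' cards0.
have odd0 : odd #|rooms rank_slack Q0|.
  have [mn [i [j [mn_in mn_min neq_ij eq_mn [inji injj]]]]] :=
    door_pair rank_slack_inj domQ0 (ne0 _ cardQ0) cardQ0.
  have mnE k : k != i0 -> mn k = inr k.
    move=> ki0; apply: (mn_uniq rank_slack_inj mn_in mn_min).
      by rewrite inrQ0.
    by move=> y _; rewrite /= eqxx.
  have [k ki0 mni0] : exists2 k, k != i0 & mn i0 = inr k.
    by have := mn_in i0; case: (mn i0) => [x|k]; rewrite ?inlQ0 ?inrQ0 //; exists k.
  wlog ii0 : i j neq_ij eq_mn inji injj / i = i0.
    move=> H; have [ii0|ii0] := eqVneq i i0; first exact: (H i j).
    have [ji0|ji0] := eqVneq j i0; first by apply: (H j i) => //; rewrite eq_sym.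
    by move: eq_mn neq_ij; rewrite !mnE // => -[->]; rewrite eqxx.
  rewrite (card_rooms rank_slack_inj domQ0 mn_in mn_min neq_ij eq_mn inji injj).
  have -> : beats rank_slack mn i != set0.
    apply/set0Pn; exists (inl x0); apply/beatsP => l; rewrite ii0 => li0.
    by rewrite mnE //= eqxx.
  have jk : j = k.
    have ji0 : j != i0 by rewrite -ii0 eq_sym.
    by move: eq_mn; rewrite ii0 mni0 mnE // => -[].
  (* [mn i0] is a slack point, hence above all genuine points in the order [i0],
     so that [beats j] contains none of them *)
  suff -> : beats rank_slack mn j == set0 by [].
  rewrite -subset0; apply/subsetP => -[x|l] /beatsP xb; exfalso.
    have i0j : i0 != j by rewrite -ii0.
    have := xb i0 i0j; rewrite mni0 ltnNge ltnW //.
    exact: rank_slack_lt.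
  have i0j : i0 != j by rewrite -ii0.
  have [li0|li0] := eqVneq l i0; first by have := xb i0 i0j; rewrite li0 /= eqxx ltn0.
  have [lj|lj] := eqVneq l j; first by have := xb i0 i0j; rewrite mni0 lj jk ltnn.
  by have := xb l lj; rewrite mnE // ltnn.
have evenQ Q : almost_colorful col_slack i0 Q -> dominant rank_slack Q -> Q != Q0 ->
    ~~ odd #|rooms rank_slack Q|.
  move=> /andP[/eqP cQ /eqP colQ] domQ QQ0.
  have [mn [i [j [mn_in mn_min neq_ij eq_mn [inji injj]]]]] :=
    door_pair rank_slack_inj domQ (ne0 _ cQ) cQ.
  have [x xQ] : exists x, inl x \in Q.
    apply/existsP; apply: contraNT QQ0; rewrite negb_exists => /forallP noinl.
    rewrite eqEcard -ltnS cQ cardQ0 leqnn andbT; apply/subsetP => -[x|k] kQ.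
      by have := noinl x; rewrite kQ.
    by rewrite inrQ0; have := imset_f col_slack kQ; rewrite colQ !inE.
  have nonempty k : beats rank_slack mn k != set0.
    apply/set0Pn; exists (inr k); apply/beatsP => l; rewrite eq_sym => lk.
    by apply: leq_ltn_trans (rank_slack_lt x lk); apply: mn_min.
  by rewrite (card_rooms rank_slack_inj domQ mn_in mn_min neq_ij eq_mn inji injj) !nonempty.
have [P /dominantP domP colP] := colorful_room aQ0 odd0 evenQ.
exists [set x | inl x \in P], [set i | inr i \notin P].
have domP' x : exists2 i, i \in [set i | inr i \notin P] &
    forall y, y \in [set x | inl x \in P] -> rk i x <= rk i y.
  have [i Hi] := domP (inl x); exists i.
    by rewrite inE; apply/negP => /Hi; rewrite /= eqxx.
  by move=> y; rewrite inE => /Hi.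
split=> //; first by have [i iC _] := domP' x0; apply/set0Pn; exists i.
move=> i; rewrite inE => iC; have : i \in col_slack @: P by rewrite colP inE.
move=> /imsetP[[y|k] yP iE]; first by exists y; rewrite ?inE.
by move: iC; rewrite iE yP.
Qed.

End Scarf.

(** * Approximate fixed points on a simplex *)

(** The grid points are the integer points of the simplex of size [m].  In the
    orders of [scarf] given by the coordinates in [C], the minima [mn k] of a
    dominant set satisfy [m < \sum_(k in C) (mn k).+1], for otherwise some grid
    point would exceed all of them.  As the coordinates of a grid point add up
    to [m], this confines the points of the dominant set to within [#|I|] of
    each other, and makes their coordinates outside [C] smaller than [#|I|]. *)
Lemma grid_rainbow (I : finType) (m : nat) (col : {ffun I -> 'I_m.+1} -> I) :
  1 < #|I| ->
  exists2 y : {ffun I -> 'I_m.+1}, \sum_i y i = m &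
  forall i, exists z : {ffun I -> 'I_m.+1},
    [/\ \sum_k z k = m,
        forall k, z k < y k + #|I| /\ y k < z k + #|I| &
        col z = i \/ z i < #|I|].
Proof.
move=> I2; have /card_gt0P[i0 _] : 0 < #|I| by apply: ltnW.
pose T : finType := {x : {ffun I -> 'I_m.+1} | \sum_i x i == m}.
have mkT (u : I -> nat) : \sum_i u i = m -> exists x : T, forall i, (val x i : nat) = u i.
  move=> um; pose x := [ffun i => inord (u i)] : {ffun I -> 'I_m.+1}.
  have xE i : x i = u i :> nat.
    rewrite ffunE inordK // ltnS -um (bigD1 i) //=; exact: leq_addr.
  have xP : \sum_i x i == m by rewrite -[X in _ == X]um; apply/eqP/eq_bigr.
  by exists (exist _ x xP).
have [x0 _] : exists x : T, forall i, (val x i : nat) = if i == i0 then m else 0.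
  by apply: mkT; rewrite -big_mkcond big_pred1_eq.
(* the enumeration rank only breaks ties *)
pose rk i (x : T) := val x i * #|T| + enum_rank x.
have rk_le i x y : rk i x <= rk i y -> val x i <= val y i.
  apply: contraTT; rewrite -!ltnNge /rk => yx.
  apply: (@leq_trans ((val y i).+1 * #|T|)); last first.
    by apply: leq_trans (leq_addr _ _); rewrite leq_mul2r yx orbT.
  by rewrite mulSn addnC ltn_add2r.
have rk_inj i : injective (rk i).
  move=> x y xy; apply: enum_rank_inj; apply: ord_inj.
  have e : val x i = val y i.
    by apply: ord_inj; apply/eqP; rewrite eqn_leq !rk_le // xy.
  by move: xy; rewrite /rk e => /addnI.
have [s [C [/set0Pn[c cC] Ccol dom]]] := scarf (fun x : T => col (val x)) rk_inj x0 I2.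
have [y ys _] := Ccol _ cC.
pose mn k : nat := val [arg min_(z < y in s) (val z k : nat)] k.
have mn_le k z : z \in s -> mn k <= val z k.
  by rewrite /mn; case: arg_minnP => // w ws wmin /wmin.
have mn_ex k : exists2 z, z \in s & mn k = val z k.
  by rewrite /mn; case: arg_minnP => // w ws wmin; exists w.
have m_lt : m < \sum_(k in C) (mn k).+1.
  rewrite ltnNge; apply/negP => le_m.
  pose u k := (if k \in C then (mn k).+1 else 0) +
              (if k == c then m - \sum_(k in C) (mn k).+1 else 0).
  have [x xu] : exists x : T, forall i, (val x i : nat) = u i.
    by apply: mkT; rewrite big_split /= -!big_mkcond big_pred1_eq subnKC.
  have [k kC xk] := dom x; have [z zs mnz] := mn_ex k.
  have := rk_le _ _ _ (xk z zs); rewrite xu /u kC -mnz leqNgt.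
  by rewrite addSn ltnS leq_addr.
have m_lt' : m < \sum_(k in C) mn k + #|I|.
  apply: leq_trans m_lt _.
  rewrite (eq_bigr (fun k => mn k + 1)) => [|k _]; last by rewrite addn1.
  by rewrite big_split /= sum1_card leq_add2l max_card.
have sum_s z : z \in s -> \sum_(k in C) mn k <= \sum_(k in C) val z k.
  by move=> zs; apply: leq_sum => k _; apply: mn_le.
have sumE (z : T) : \sum_k val z k = m by apply/eqP/(valP z).
have in_C k z : k \in C -> z \in s -> val z k < mn k + #|I|.
  move=> kC zs; move: m_lt'; rewrite -{1}(sumE z) (bigID (mem C)) /=.
  rewrite (bigD1 k) //= [X in _ < X + _](bigD1 k) //= => H.
  have : \sum_(i in C | i != k) mn i <= \sum_(i in C | i != k) val z i.
    by apply: leq_sum => i _; apply: mn_le.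
  by move=> /=; lia.
have out_C k z : k \notin C -> z \in s -> val z k < #|I|.
  move=> kC zs; move: m_lt'; rewrite -{1}(sumE z) (bigID (mem C)) /=.
  rewrite (bigD1 (P := fun k => k \notin C) k) //= => H.
  rewrite -(ltn_add2l (\sum_(k in C) mn k)); apply: leq_ltn_trans H.
  by apply: leq_add; [exact: sum_s | exact: leq_addr].
exists (val y); first exact: sumE.
have close z k : z \in s -> val z k < val y k + #|I| /\ val y k < val z k + #|I|.
  move=> zs; have [kC|kC] := boolP (k \in C); last first.
    by split; apply: leq_trans (leq_addl _ _); apply: out_C.
  by split; apply: leq_trans (in_C _ _ kC _) _; rewrite ?leq_add2r ?mn_le.
move=> i; have [/Ccol[z zs zi]|iC] := boolP (i \in C).
  by exists (val z); split; [exact: sumE | move=> k; exact: close | left].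
exists (val y); split; [exact: sumE | move=> k; exact: close | right].
exact: out_C.
Qed.

Import Order.TTheory GRing.Theory Num.Theory.
Local Open Scope ring_scope.

Definition simplex (R : numDomainType) (I : finType) (L : R) (x : I -> R) :=
  (forall i, 0 <= x i) /\ \sum_i x i = L.

(** A grid point is coloured by a coordinate that [F] does not decrease.  The
    point [y] of [grid_rainbow] has near it, for each [i], either a point at
    which [F] does not decrease the coordinate [i], or a point whose coordinate
    [i] is almost zero; either way [F] decreases no coordinate of [y] by more
    than a small amount, and the sum of the coordinates being fixed it cannot
    increase one by much. *)
Theorem approx_brouwer (R : archiRealFieldType) (I : finType) (L : R)
    (F : (I -> R) -> I -> R) (e : R) :
  (1 < #|I|)%N -> 0 < L -> 0 < e ->
  (forall x, simplex L x -> simplex L (F x)) ->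
  (forall e, 0 < e -> exists2 d, 0 < d & forall x y,
     simplex L x -> simplex L y -> (forall i, `|x i - y i| <= d) ->
     forall i, `|F x i - F y i| <= e) ->
  exists2 x, simplex L x & forall i, `|F x i - x i| <= e.
Proof.
move=> I2 L0 e0 FS Fc.
have I0 : 0 < (#|I|%:R : R) by rewrite ltr0n ltnW.
pose e1 := e / (3 * #|I|%:R); have e10 : 0 < e1 by rewrite divr_gt0 // mulr_gt0.
have [d d0 Fd] := Fc _ e10.
pose q := Num.min d e1; have q0 : 0 < q by rewrite lt_min d0.
pose m := (Num.truncn (L * #|I|%:R / q)).+1.
have m0 : 0 < (m%:R : R) by rewrite ltr0n.
pose h := L / m%:R; have h0 : 0 < h by rewrite divr_gt0.
have hI : h * #|I|%:R <= q.
  rewrite /h mulrAC ler_pdivrMr // [leRHS]mulrC -ler_pdivrMr //; apply: ltW.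
  by apply: truncnS_gt.
pose pt (z : {ffun I -> 'I_m.+1}) i := h * (z i)%:R.
have ptS (z : {ffun I -> 'I_m.+1}) : (\sum_k z k = m)%N -> simplex L (pt z).
  move=> zm; split=> [i|]; first by rewrite mulr_ge0 ?ler0n ?ltW.
  by rewrite -mulr_sumr -natr_sum zm /h mulfVK ?gt_eqF.
have /card_gt0P[i0 _] : (0 < #|I|)%N by apply: ltnW.
pose col z := odflt i0 [pick i | pt z i <= F (pt z) i].
have colP (z : {ffun I -> 'I_m.+1}) : (\sum_k z k = m)%N ->
    pt z (col z) <= F (pt z) (col z).
  move=> /ptS zS; rewrite /col; case: pickP => [i //|noi]; exfalso.
  have [_ sz] := zS; have [_ sF] := FS _ zS.
  suff : \sum_i F (pt z) i < \sum_i pt z i by rewrite sz sF ltxx.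
  apply: ltr_sum => [|i _]; last by rewrite ltNge noi.
  by apply/hasP; exists i0; rewrite ?mem_index_enum.
have [y ym yrain] := grid_rainbow col I2.
have yS := ptS _ ym; exists (pt y) => //.
have lo i : pt y i - 3 * e1 <= F (pt y) i.
  have [z [zm zy zcol]] := yrain i; have zS := ptS _ zm.
  have zyq k : `|pt y k - pt z k| <= q.
    apply: le_trans hI; rewrite /pt -mulrBr normrM gtr0_norm // ler_pM2l //.
    have [zk yk] := zy k; rewrite ler_distl lerBlDr -!natrD !ler_nat.
    by apply/andP; split; apply: ltnW.
  have zyd k : `|pt y k - pt z k| <= d.
    by apply: le_trans (zyq k) _; rewrite ge_min lexx.
  have := zyq i; rewrite le_min => /andP[_]; rewrite ler_distl => /andP[_ yz].
  have := Fd _ _ yS zS zyd i; rewrite ler_distl => /andP[FF _].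
  have zF : pt z i - e1 <= F (pt z) i.
    case: zcol => [<-|zi].
      by apply: le_trans (colP _ zm); rewrite gerBl ltW.
    apply: le_trans (proj1 (FS _ zS) i); rewrite subr_le0.
    have : q <= e1 by rewrite ge_min lexx orbT.
    apply: le_trans; apply: le_trans hI; rewrite ler_pM2l //.
    by rewrite ler_nat ltnW.
  apply: le_trans FF; rewrite lerBrDr; apply: le_trans zF.
  lra.
move=> i; have e3 : 3 * e1 * #|I|%:R = e by rewrite /e1; field; rewrite gt_eqF.
have [_ sy] := yS; have [_ sF] := FS _ yS.
have hi : F (pt y) i - pt y i = \sum_(k | k != i) (pt y k - F (pt y) k).
  rewrite sumrB; move: sy sF; rewrite (bigD1 i) //= [in X in _ -> X](bigD1 i) //=.
  lra.
have I1 : 1 <= (#|I|%:R : R) by rewrite ler1n ltnW.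
rewrite ler_distl; apply/andP; split.
  by apply: le_trans (lo i); rewrite lerB // -e3 ler_peMr // mulr_ge0 // ltW.
rewrite -lerBlDl hi -e3.
apply: (@le_trans _ _ (\sum_(k | k != i) 3 * e1)).
  by apply: ler_sum => k _; have := lo k; lra.
rewrite sumr_const -[leLHS]mulr_natr ler_pM2l ?(mulr_gt0 _ e10) //.
by rewrite ler_nat max_card.
Qed.

From mathcomp Require Import all_classical all_reals all_analysis.
Import numFieldNormedType.Exports.
Local Open Scope classical_set_scope.
Local Open Scope ring_scope.

(** * Uniform continuity and truncation *)

(** The Heine-Cantor theorem relative to a compact subset. *)
Lemma compact_uniformly_continuous (R : realType) (U : pseudoMetricType R)
    (K : set U) (h : U -> R) :
  compact K -> {within K, continuous h} ->
  forall e, 0 < e -> exists2 d, 0 < d &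
    forall p q, K p -> K q -> ball p d q -> `|h p - h q| <= e.
Proof.
move=> /compact_near_coveringP cK hc e e0.
have e20 : 0 < e / 2 by rewrite divr_gt0.
have loc p : K p -> exists2 d, 0 < d & forall q, K q -> ball p d q -> `|h p - h q| < e / 2.
  move=> Kp; have /subspace_continuousP/(_ p Kp) := hc.
  move=> /cvgrPdist_lt/(_ _ e20).
  rewrite near_withinE => /nbhs_ballP[d d0 hd]; exists d => // q Kq pq.
  exact: hd.
pose P (d : R) p := forall q, K p -> K q -> ball p d q -> `|h p - h q| <= e.
have : \forall d \near 0^'+, K `<=` P d.
  apply: cK => p /loc[d d0 pd].
  exists (ball p (d / 2), [set d' | d' <= d / 2]) => /=.
    split; first by apply: nbhsx_ballx; rewrite divr_gt0.
    by apply: nbhs_right_le; rewrite divr_gt0.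
  move=> [p' d'] /= [pp' d'd] q Kp' Kq p'q.
  have pq : ball p d q.
    by rewrite [d]splitr; apply: ball_triangle pp' _; apply: le_ball p'q.
  have p'd : ball p d p' by apply: le_ball pp'; lra.
  have := pd _ Kq pq; have := pd _ Kp' p'd.
  have -> : h p' - h q = (h p - h q) - (h p - h p') by ring.
  move=> h1 h2; apply: le_trans (ler_normB _ _) _; rewrite [e]splitr.
  by apply: lerD; apply: ltW.
move=> PK; near (0 : R)^'+ => d; exists d; first by [].
have PKd : K `<=` P d by near: d.
by move=> p q Kp Kq; apply: PKd.
Unshelve. all: by end_near. Qed.

Section Clamp.
Context {R : realType}.
Implicit Types lo hi t s : R.

Definition clamp lo hi t : R := Num.max lo (Num.min hi t).

Lemma clamp_ge lo hi t : lo <= clamp lo hi t.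
Proof. by rewrite /clamp le_max lexx. Qed.

Lemma clamp_le lo hi t : lo <= hi -> clamp lo hi t <= hi.
Proof. by move=> lh; rewrite /clamp ge_max lh ge_min lexx. Qed.

Lemma clamp_id lo hi t : lo <= t <= hi -> clamp lo hi t = t.
Proof. by move=> /andP[lt th]; rewrite /clamp (min_r th) (max_r lt). Qed.

Lemma clamp_dist lo hi s t : `|clamp lo hi s - clamp lo hi t| <= `|s - t|.
Proof.
rewrite /clamp; case: (leP hi s) => ?; case: (leP hi t) => ?.
all: case: (leP lo _) => ?; try case: (leP lo _) => ?.
all: by rewrite ler_norml; case: (ger0P (s - t)) => ?; apply/andP; split; lra.
Qed.

End Clamp.

Section Continuity.
Context {R : realType}.

Definition modulus_on (D : set R) (x : R -> R) e d :=
  forall s t, D s -> D t -> `|s - t| <= d -> `|x s - x t| <= e.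

Lemma clamp_continuous (lo hi : R) : continuous (clamp lo hi).
Proof.
move=> t; apply/cvgrPdist_le => e e0; near=> s.
apply: le_trans (clamp_dist _ _ _ _) _; apply: ltW.
by near: s; apply: cvgr_dist_lt.
Unshelve. all: by end_near. Qed.

Lemma unitI_clamp (t : R) : unitI (clamp 0 1 t).
Proof. by rewrite /unitI /= in_itv /= clamp_ge clamp_le. Qed.

(** Composing with [clamp 0 1] turns a function that is only controlled on the
    unit interval into one that is continuous on the whole line. *)
Lemma clamp_continuous_comp (x : R -> R) :
  (forall e, 0 < e -> exists2 d, 0 < d & modulus_on unitI x e d) ->
  continuous (x \o clamp 0 1).
Proof.
move=> xm t; apply/cvgrPdist_le => e e0; have [d d0 xd] := xm e e0.
near=> s => /=; apply: xd; [exact: unitI_clamp|exact: unitI_clamp|].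
apply: le_trans (clamp_dist _ _ _ _) _; apply: ltW.
by near: s; apply: cvgr_dist_lt.
Unshelve. all: by end_near. Qed.

End Continuity.

(** * Schauder's theorem for operators on curves *)

Section Mesh.
Context {R : realType}.
Variable N : nat.
Implicit Types t : R.

Definition node (k : 'I_N.+1) : R := k%:R / N%:R.

Lemma near_node t : 0 <= t <= 1 -> exists k : 'I_N.+1, `|N%:R * t - k%:R| < 1.
Proof.
move=> /andP[t0 t1]; have Nt0 : 0 <= N%:R * t by rewrite mulr_ge0.
have /andP[tle ltt] := truncn_itv Nt0.
have kN : (Num.truncn (N%:R * t) < N.+1)%N.
  by rewrite ltnS -(ler_nat R); apply: le_trans tle _; rewrite ler_piMr.
exists (Ordinal kN); rewrite /= ger0_norm ?subr_ge0 //.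
by rewrite ltrBlDr -[1]/(1%:R) -natrD add1n.
Qed.

Hypothesis N_gt0 : (0 < N)%N.

Lemma node_unit k : unitI (node k).
Proof.
rewrite /unitI /= in_itv /= /node divr_ge0 //= ler_pdivrMr ?ltr0n // mul1r ler_nat.
by rewrite -ltnS.
Qed.

Lemma node_dist t (k : 'I_N.+1) : `|N%:R * t - k%:R| < 1 -> `|t - node k| <= N%:R^-1.
Proof.
have N0 : 0 < (N%:R : R) by rewrite ltr0n.
have -> : t - node k = (N%:R * t - k%:R) / N%:R by rewrite /node; field; rewrite gt_eqF.
by rewrite normrM normfV (gtr0_norm N0) ler_pdivrMr // mulVf ?gt_eqF // => /ltW.
Qed.

End Mesh.

Lemma fine_mesh (R : realType) (d : R) : 0 < d ->
  exists2 N, (0 < N)%N & N%:R^-1 <= d.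
Proof.
move=> d0; exists (Num.truncn d^-1).+1 => //.
rewrite -[leRHS]invrK lef_pV2 ?posrE ?invr_gt0 ?ltr0n //.
exact/ltW/truncnS_gt.
Qed.

Section Interpolation.
Context {R : realType}.
Variable N : nat.
Implicit Types (v w : 'I_N.+1 -> R) (s e c : R).

Definition hat (k : nat) s : R := 1 - clamp 0 1 `|N%:R * s - k%:R|.

Definition interpol v s : R :=
  (\sum_k v k * hat k (clamp 0 1 s)) / \sum_(k < N.+1) hat k (clamp 0 1 s).

Lemma hat_ge0 k s : 0 <= hat k s.
Proof. by rewrite subr_ge0 clamp_le. Qed.

Lemma hat_eq0 k s : 1 <= `|N%:R * s - k%:R| -> hat k s = 0.
Proof. by move=> h; rewrite /hat /clamp (min_l h) max_r ?subrr. Qed.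

Lemma sum_hat_gt0 s : 0 < \sum_(k < N.+1) hat k (clamp 0 1 s).
Proof.
have [|k near_k] := @near_node R N (clamp 0 1 s); first by rewrite clamp_ge clamp_le.
rewrite (bigD1 k) //=; apply: ltr_pwDl; last first.
  by apply: sumr_ge0 => i _; apply: hat_ge0.
by rewrite /hat subr_gt0 clamp_id // normr_ge0 ltW.
Qed.

(** The interpolation is a weighted mean of the values at the nodes close to
    [s], so it cannot be farther from [c] than these values. *)
Lemma interpol_close v s c e : 0 <= e ->
  (forall k : 'I_N.+1, `|N%:R * clamp 0 1 s - k%:R| < 1 -> `|v k - c| <= e) ->
  `|interpol v s - c| <= e.
Proof.
move=> e0 vc; have W0 := sum_hat_gt0 s.
have -> : interpol v s - c =
    (\sum_k (v k - c) * hat k (clamp 0 1 s)) / \sum_(k < N.+1) hat k (clamp 0 1 s).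
  rewrite [X in X / _](_ : _ = \sum_k v k * hat k (clamp 0 1 s) -
      c * \sum_(k < N.+1) hat k (clamp 0 1 s)); last first.
    by rewrite mulr_sumr -[RHS]sumrB; apply: eq_bigr => k _; rewrite mulrBl.
  by rewrite mulrBl mulfK // gt_eqF.
rewrite normrM normfV (gtr0_norm W0) ler_pdivrMr // mulr_sumr.
apply: le_trans (ler_norm_sum _ _ _) _; apply: ler_sum => k _.
rewrite normrM (ger0_norm (hat_ge0 _ _)).
have [lt1|ge1] := ltP (`|N%:R * clamp 0 1 s - k%:R|) 1.
  by rewrite ler_wpM2r ?hat_ge0 ?vc.
by rewrite hat_eq0 // !mulr0.
Qed.

Lemma interpol_dist v w s e : 0 <= e -> (forall k, `|v k - w k| <= e) ->
  `|interpol v s - interpol w s| <= e.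
Proof.
move=> e0 vw.
have -> : interpol v s - interpol w s = interpol (fun k => v k - w k) s - 0.
  rewrite subr0 /interpol -mulrBl -sumrB; congr (_ / _).
  by apply: eq_bigr => k _; rewrite mulrBl.
by apply: interpol_close => // k _; rewrite subr0.
Qed.

Lemma hat_continuous k : continuous (hat k).
Proof.
move=> s; apply: cvgB; first exact: cvg_cst.
apply: (@cvg_comp _ _ _ (fun s => `|N%:R * s - k%:R|) (clamp 0 1)); last exact: clamp_continuous.
by apply: cvg_norm; apply: cvgB; [apply: cvgM; [exact: cvg_cst|exact: cvg_id]|exact: cvg_cst].
Qed.

Lemma interpol_continuous v : continuous (interpol v).
Proof.
move=> s; have hc k : hat k (clamp 0 1 t) @[t --> s] --> hat k (clamp 0 1 s).
  apply: (@cvg_comp _ _ _ (clamp 0 1) (hat k)); last exact: hat_continuous.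
  exact: clamp_continuous.
apply: cvgM.
  apply: cvg_big; first exact: add_continuous.
  by move=> k _; apply: cvgM; [exact: cvg_cst|exact: hc].
apply: cvgV; first by rewrite gt_eqF // sum_hat_gt0.
by apply: cvg_big; [exact: add_continuous|move=> k _; exact: hc].
Qed.

End Interpolation.

Lemma sum_option (V : nmodType) (A : finType) (f : option A -> V) :
  \sum_o f o = f None + \sum_a f (Some a).
Proof.
rewrite (bigD1 None) //=; congr (_ + _).
rewrite (reindex_omap Some id) => [|[a|] //].
by apply: eq_bigl => a; rewrite eqxx.
Qed.

Section Schauder.
Context {R : realType}.
Variables (I : finType) (T : (I -> R -> R) -> I -> R -> R) (M : R).
Implicit Types x y : I -> R -> R.

(** Curves are continuous on the whole line although only their restrictions to
    the unit interval matter: continuity needs then no subspace topology. *)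
Definition curve x := forall i, continuous (x i).

Definition close_on_unit x y e :=
  forall i t, unitI t -> `|x i t - y i t| <= e.

Hypothesis M_gt0 : 0 < M.
Hypothesis T_bound : forall x, curve x -> forall i t, unitI t -> 0 <= T x i t <= M.
Hypothesis T_equicont : forall e : R, 0 < e -> exists2 d : R, 0 < d &
  forall x, curve x -> forall i, modulus_on unitI (T x i) e d.
Hypothesis T_cont : forall e : R, 0 < e -> exists2 d : R, 0 < d &
  forall x y, curve x -> curve y -> close_on_unit x y d -> close_on_unit (T x) (T y) e.

(** The values at the nodes of a fine mesh are the coordinates of a simplex
    whose last vertex absorbs the slack.  An approximate fixed point of the map
    that interpolates, applies [T] and samples is a curve that [T] moves little at
    the nodes, hence everywhere by equicontinuity. *)
Lemma approx_fixed_curve (i0 : I) (e : R) : 0 < e ->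
  exists2 x, curve x & close_on_unit x (T x) e.
Proof.
move=> e0; have e20 : 0 < e / 2 by rewrite divr_gt0.
(* between two nodes [T x] varies by at most [e / 2] *)
have [d d0 Td] := T_equicont e20.
have [N N0 Nd] := fine_mesh d0.
pose P (z : option (I * 'I_N.+1) -> R) i := interpol (fun k => z (Some (i, k))).
have Pc z : curve (P z) by move=> i; exact: interpol_continuous.
pose c := #|{: I * 'I_N.+1}|; pose L := M * (c.+1)%:R.
have L0 : 0 < L by rewrite mulr_gt0.
pose S z := \sum_(p : I * 'I_N.+1) T (P z) p.1 (node p.2).
pose F (z : option (I * 'I_N.+1) -> R) (o : option (I * 'I_N.+1)) :=
  match o with Some p => T (P z) p.1 (node p.2) | None => L - S z end.
have FS z : simplex L z -> simplex L (F z).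
  move=> _; split; last by rewrite sum_option /= subrK.
  move=> [p|] /=; first by have /andP[] := T_bound (Pc z) p.1 (@node_unit R N N0 p.2).
  rewrite subr_ge0; apply: (@le_trans _ _ (\sum_(p : I * 'I_N.+1) M)).
    by apply: ler_sum => p _; have /andP[] := T_bound (Pc z) p.1 (@node_unit R N N0 p.2).
  by rewrite sumr_const -mulr_natr /L ler_pM2l // ler_nat.
have Fc (e' : R) : 0 < e' -> exists2 d : R, 0 < d & forall z w,
     simplex L z -> simplex L w -> (forall o, `|z o - w o| <= d) ->
     forall o, `|F z o - F w o| <= e'.
  move=> e'0; have q0 : 0 < e' / c.+1%:R by rewrite divr_gt0.
  have [d' d'0 Td'] := T_cont q0.
  exists d' => // z w _ _ zw.
  have TPzw (p : I * 'I_N.+1) : `|T (P z) p.1 (node p.2) - T (P w) p.1 (node p.2)| <= e' / c.+1%:R.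
    apply: Td' => //; last exact: node_unit.
    move=> i t _; apply: interpol_dist; first exact: ltW.
    by move=> k; apply: zw.
  move=> [p|] /=.
    apply: le_trans (TPzw p) _; rewrite ler_pdivrMr //.
    by apply: ler_peMr; [exact: ltW|rewrite ler1n].
  have -> : L - S z - (L - S w) = \sum_(p : I * 'I_N.+1)
      - (T (P z) p.1 (node p.2) - T (P w) p.1 (node p.2)).
    by rewrite sumrN sumrB /S; ring.
  apply: le_trans (ler_norm_sum _ _ _) _.
  apply: (@le_trans _ _ (\sum_(p : I * 'I_N.+1) (e' / c.+1%:R))).
    by apply: ler_sum => p _; rewrite normrN.
  rewrite sumr_const -[leLHS]mulr_natr -/c mulrAC ler_pdivrMr // ler_pM2l //.
  by rewrite ler_nat.
have card2 : (1 < #|{: option (I * 'I_N.+1)}|)%N.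
  rewrite card_option card_prod card_ord ltnS muln_gt0 andbT.
  by apply/card_gt0P; exists i0.
have [z _ zF] := approx_brouwer card2 L0 e20 FS Fc.
exists (P z) => // i t tI; have t01 : 0 <= t <= 1 by move: tI; rewrite /unitI /= in_itv.
apply: interpol_close => [|k]; first exact: ltW.
rewrite (clamp_id t01) => tk.
have -> : z (Some (i, k)) - T (P z) i t =
  (T (P z) i (node k) - T (P z) i t) - (F z (Some (i, k)) - z (Some (i, k))).
  by rewrite /F /=; ring.
apply: le_trans (ler_normB _ _) _; rewrite [e]splitr; apply: lerD; last exact: zF.
apply: Td => //; first exact: node_unit.
by apply: le_trans Nd; rewrite distrC; apply: node_dist.
Qed.

(** An ultrafilter forces a cluster point to be a limit. *)
Lemma bounded_ultra_limit (X : Type) (U : set_system X) (a : X -> R) lo hi :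
  UltraFilter U -> (forall n, lo <= a n <= hi) ->
  exists l, forall e : R, 0 < e -> U [set n | `|a n - l| <= e].
Proof.
move=> UU ab.
have PU : ProperFilter (a @ U) by apply: fmap_proper_filter.
have aU : (a @ U) [set` `[lo, hi]].
  by apply: (@filterS _ U _ setT _ _ filterT) => n _; rewrite /= in_itv /= ab.
have [l [_ lcl]] := @segment_compact R lo hi _ PU aU.
exists l => e e0; have [//|UA] := in_ultra_setVsetC [set n | `|a n - l| <= e] UU.
have [v [/= + lv]] := lcl [set v | ~ `|v - l| <= e] _ UA (nbhsx_ballx l e e0).
by case; rewrite distrC; apply: ltW.
Qed.

(** Let [xs n] be moved by at most [1 / (n + 1)].  Along an ultrafilter the
    curves [T (xs n)] converge pointwise; the limit inherits their modulus of
    continuity, so the convergence on a finite mesh upgrades to uniform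
    convergence.  Then [xs n] converges uniformly to the same limit, which
    [T] fixes by continuity. *)
Theorem schauder_curves (i0 : I) :
  exists2 x, curve x & forall i t, unitI t -> T x i t = x i t.
Proof.
have /choice[xs xsP] : forall n : nat, exists x, curve x /\ close_on_unit x (T x) n.+1%:R^-1.
  move=> n; have [|x xc xT] := @approx_fixed_curve i0 n.+1%:R^-1; last by exists x.
  by rewrite invr_gt0.
have xc n := (xsP n).1; have xT n := (xsP n).2.
have [U [UU subU]] := ultraFilterLemma (@eventually_filter).
have /choice[l lP] : forall p : I * R, exists l, forall e : R, 0 < e ->
    U [set n | `|T (xs n) p.1 (clamp 0 1 p.2) - l| <= e].
  move=> [i t]; apply: (@bounded_ultra_limit _ U _ 0 M UU) => n /=.
  exact/T_bound/unitI_clamp.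
pose g i t := l (i, t).
have gP i t e : 0 < e -> unitI t -> U [set n | `|T (xs n) i t - g i t| <= e].
  by move=> e0 tI; have := lP (i, t) _ e0 => /=; rewrite clamp_id.
have gm e : 0 < e -> exists2 d : R, 0 < d & forall i, modulus_on unitI (g i) e d.
  move=> e0; have e30 : 0 < e / 3 by rewrite divr_gt0.
  have [d d0 Td] := T_equicont e30; exists d => // i s t sI tI st.
  have [n [/= ns nt]] := filter_ex (filterI (gP i s _ e30 sI) (gP i t _ e30 tI)).
  have := Td _ (xc n) i s t sI tI st.
  move: ns nt; rewrite !ler_norml => /andP[? ?] /andP[? ?] /andP[? ?].
  by apply/andP; split; lra.
pose x i := g i \o clamp 0 1.
have xE i t : unitI t -> x i t = g i t.
  by rewrite /unitI /x /= in_itv /= => t01; rewrite clamp_id.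
have curve_x : curve x.
  by move=> i; apply: clamp_continuous_comp => e /gm[d d0 dP]; exists d.
have unif e : 0 < e -> U [set n | close_on_unit (T (xs n)) x e].
  move=> e0; have e30 : 0 < e / 3 by rewrite divr_gt0.
  have [d1 d10 Td] := T_equicont e30; have [d2 d20 gd] := gm _ e30.
  have [|N N0] := @fine_mesh R (Num.min d1 d2); first by rewrite lt_min d10.
  rewrite le_min => /andP[Nd1 Nd2].
  have : U [set n | forall p : I * 'I_N.+1, `|T (xs n) p.1 (node p.2) - g p.1 (node p.2)| <= e / 3].
    by apply: filter_forall => p; apply: gP => //; apply: node_unit.
  apply: filterS => n /= nP i t tI; rewrite xE //.
  have [k near_k] : exists k : 'I_N.+1, `|N%:R * t - k%:R| < 1.
    by apply: near_node; move: tI; rewrite /unitI /= in_itv.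
  have kI := @node_unit R N N0 k; have tk := node_dist N0 near_k.
  have := Td _ (xc n) i t (node k) tI kI (le_trans tk Nd1).
  have := gd i t (node k) tI kI (le_trans tk Nd2).
  have := nP (i, k) => /=.
  rewrite !ler_norml => /andP[? ?] /andP[? ?] /andP[? ?].
  by apply/andP; split; lra.
exists x => // i t tI; apply/eqP; rewrite -subr_eq0 -normr_le0.
apply/ler_addgt0Pr => e e0; rewrite add0r.
have e20 : 0 < e / 2 by rewrite divr_gt0.
have [d d0 Td] := T_cont e20; have d20 : 0 < d / 2 by rewrite divr_gt0.
have q0 : 0 < Num.min (d / 2) (e / 2) by rewrite lt_min d20.
have Un : U [set n | n.+1%:R^-1 <= d / 2].
  apply: subU; near=> n; apply: ltW; near: n.
  exact: (near_infty_natSinv_lt (PosNum d20)).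
have [n [/= cn nd]] := filter_ex (filterI (unif _ q0) Un).
have xd : close_on_unit x (xs n) d.
  move=> j s sI; have := cn j s sI; rewrite le_min => /andP[+ _].
  have := le_trans (xT n j s sI) nd.
  rewrite !ler_norml => /andP[? ?] /andP[? ?].
  by apply/andP; split; lra.
have := Td _ _ curve_x (xc n) xd i t tI.
have := cn i t tI; rewrite le_min => /andP[_].
rewrite !ler_norml => /andP[? ?] /andP[? ?].
by apply/andP; split; lra.
Unshelve. all: by end_near. Qed.

End Schauder.

(** * Integrals over the unit interval and kernel operators *)

Lemma compact_continuous_bounded (R : realType) (U : topologicalType)
    (K : set U) (h : U -> R) :
  compact K -> {within K, continuous h} ->
  exists2 C, 0 < C & forall p, K p -> `|h p| <= C.
Proof.
move=> cK hc.
have /compact_bounded[M [_ MP]] := @continuous_compact _ R^o h K hc cK.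
exists (Num.max 1 (M + 1)); first by rewrite lt_max ltr01.
move=> p Kp; apply: MP; last by exists p.
by rewrite lt_max ltrDl ltr01 orbT.
Qed.

(** Finitely many conditions that hold for all small radii have a common
    radius. *)
Lemma uniform_radius (R : realType) (I : finType) (P : I -> R -> Prop) :
  (forall i, exists2 d, 0 < d & forall d', 0 < d' -> d' <= d -> P i d') ->
  exists2 d, 0 < d & forall i, P i d.
Proof.
move=> Pd; have : \forall d \near 0^'+, forall i, P i d.
  apply: filter_forall => i; have [d d0 dP] := Pd i.
  by near=> d'; apply: dP => //; near: d'; apply: nbhs_right_le.
move=> PI; near (0 : R)^'+ => d; exists d; first by [].
by near: d.
Unshelve. all: end_near. Qed.

Section UnitIntegrals.
Context {R : realType}.
Local Notation mu := (@lebesgue_measure R).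
Implicit Types (E : set R) (g h : R -> R).

Definition unit_cont g := {within unitI, continuous g}.

Lemma modulus_unit_cont g :
  (forall e : R, 0 < e -> exists2 d : R, 0 < d & modulus_on unitI g e d) ->
  unit_cont g.
Proof.
move=> gm; apply/subspace_continuousP => s sI.
apply/cvgrPdist_le => e e0; have [d d0 gd] := gm e e0.
rewrite near_withinE; apply: filterS (nbhsx_ballx (s : R^o) d d0) => t st tI.
by apply: gd => //; apply: ltW.
Qed.

Lemma unit_contM g h : unit_cont g -> unit_cont h -> unit_cont (g \* h).
Proof. by move=> gc hc s; apply: cvgM; [apply: gc|apply: hc]. Qed.

Lemma measurable_unitI : measurable (unitI : set (measurableTypeR R)).
Proof. exact: measurable_itv. Qed.

Variable E : set R.
Hypotheses (mE : measurable (E : set (measurableTypeR R))) (EI : E `<=` unitI).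

Lemma unit_cont_integrable g : unit_cont g -> mu.-integrable E (EFin \o g).
Proof.
move=> gc; apply: (integrableS measurable_unitI mE EI).
by apply: continuous_compact_integrable => //; apply: segment_compact.
Qed.

Lemma unit_cont_cst (k : R) : unit_cont (fun=> k).
Proof. by apply: continuous_subspaceT => s; apply: cvg_cst. Qed.

Lemma measure_unit : 0 <= fine (mu E) <= 1.
Proof.
have muI : mu unitI = 1%E by rewrite /unitI lebesgue_measure_itv /= lte_fin ltr01 sube0.
have le1 : (mu E <= 1)%E.
  by rewrite -muI; apply: le_measure; rewrite ?inE //; exact: measurable_unitI.
rewrite fine_ge0 // -[1]/(fine 1%E) fine_le // ge0_fin_numE //.
by apply: le_lt_trans le1 _; rewrite ltry.
Qed.

Lemma le_unit_integral g h :
  unit_cont g -> unit_cont h -> (forall s, E s -> g s <= h s) ->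
  \int[mu]_(s in E) g s <= \int[mu]_(s in E) h s.
Proof.
move=> gc hc; exact: (le_Rintegral mE (unit_cont_integrable gc) (unit_cont_integrable hc)).
Qed.

Lemma le_unit_integral_shift g h k : 0 <= k ->
  unit_cont g -> unit_cont h -> (forall s, E s -> g s <= h s + k) ->
  \int[mu]_(s in E) g s <= \int[mu]_(s in E) h s + k.
Proof.
move=> k0 gc hc gh; have kc : unit_cont (fun=> k) by exact: unit_cont_cst.
apply: (@le_trans _ _ (\int[mu]_(s in E) (h s + k))).
  apply: le_unit_integral => //.
  by move=> s; apply: cvgD; [apply: hc|apply: kc].
rewrite (RintegralD mE (unit_cont_integrable hc) (unit_cont_integrable kc)).
rewrite lerD2l (Rintegral_cst mu mE); have /andP[_ m1] := measure_unit.
by rewrite ler_piMr.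
Qed.

Lemma unit_integral_dist g h k : 0 <= k ->
  unit_cont g -> unit_cont h -> (forall s, E s -> `|g s - h s| <= k) ->
  `|\int[mu]_(s in E) g s - \int[mu]_(s in E) h s| <= k.
Proof.
move=> k0 gc hc gh.
have ghk : \int[mu]_(s in E) g s <= \int[mu]_(s in E) h s + k.
  by apply: le_unit_integral_shift => // s /gh; rewrite ler_norml => /andP[? ?]; lra.
have hgk : \int[mu]_(s in E) h s <= \int[mu]_(s in E) g s + k.
  by apply: le_unit_integral_shift => // s /gh; rewrite ler_norml => /andP[? ?]; lra.
by rewrite ler_norml; apply/andP; split; lra.
Qed.

Lemma unit_integral_scale g k : unit_cont g ->
  \int[mu]_(s in E) (g s * k) = (\int[mu]_(s in E) g s) * k.
Proof. by move=> gc; rewrite RintegralZr //; apply: unit_cont_integrable. Qed.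

End UnitIntegrals.

Section Kernel.
Context {R : realType}.
Local Notation mu := (@lebesgue_measure R).
Variable G : R -> R -> R.
Hypothesis G_cont :
  {within unitI `*` unitI, continuous (fun p : R * R => G p.1 p.2)}.

Lemma unit_square_compact : compact (unitI `*` unitI : set (R * R)).
Proof. by apply: compact_setX; apply: segment_compact. Qed.

Lemma kernel_bounded : exists2 C, 0 < C &
  forall t s, unitI t -> unitI s -> `|G t s| <= C.
Proof.
have [C C0 GC] := compact_continuous_bounded unit_square_compact G_cont.
by exists C => // t s tI sI; apply: (GC (t, s)).
Qed.

Lemma kernel_modulus e : 0 < e -> exists2 d, 0 < d &
  forall t s t' s', unitI t -> unitI s -> unitI t' -> unitI s' ->
    `|t - t'| <= d -> `|s - s'| <= d -> `|G t s - G t' s'| <= e.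
Proof.
move=> /(compact_uniformly_continuous unit_square_compact G_cont)[d d0 dP].
have d20 : 0 < d / 2 by rewrite divr_gt0.
exists (d / 2) => // t s t' s' tI sI t'I s'I tt' ss'.
apply: (dP (t, s) (t', s')) => //.
have lt2 : d / 2 < d by lra.
by split; rewrite /ball /=; [apply: le_lt_trans tt' _|apply: le_lt_trans ss' _].
Qed.

Lemma kernel_unit_cont t : unitI t -> unit_cont (G t).
Proof.
move=> tI; apply: modulus_unit_cont => e /kernel_modulus[d d0 dP].
by exists d => // s s' sI s'I ss'; apply: dP => //; rewrite subrr normr0 ltW.
Qed.

Variable E : set R.
Hypotheses (mE : measurable (E : set (measurableTypeR R))) (EI : E `<=` unitI).

Definition kernel_op (u : R -> R) t : R := \int[mu]_(s in E) (G t s * u s).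

Lemma kernel_op_integrand t u : unitI t -> unit_cont u ->
  unit_cont (fun s => G t s * u s).
Proof. by move=> tI uc; apply: unit_contM => //; apply: kernel_unit_cont. Qed.

Lemma kernel_op_dist C u v t e :
  (forall t s, unitI t -> unitI s -> `|G t s| <= C) -> 0 <= C -> 0 <= e ->
  unit_cont u -> unit_cont v -> (forall s, E s -> `|u s - v s| <= e) ->
  unitI t -> `|kernel_op u t - kernel_op v t| <= C * e.
Proof.
move=> GC C0 e0 uc vc uv tI; apply: unit_integral_dist => //.
- by rewrite mulr_ge0.
- exact: kernel_op_integrand.
- exact: kernel_op_integrand.
move=> s Es; rewrite -mulrBr normrM ler_pM //; last exact: uv.
by apply: GC => //; apply: EI.
Qed.

Lemma kernel_op_modulus C u e t t' :
  (forall s, unitI s -> `|u s| <= C) -> 0 <= C -> 0 <= e ->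
  unit_cont u -> unitI t -> unitI t' ->
  (forall s, unitI s -> `|G t s - G t' s| <= e) ->
  `|kernel_op u t - kernel_op u t'| <= e * C.
Proof.
move=> uC C0 e0 uc tI t'I Gtt; apply: unit_integral_dist => //.
- by rewrite mulr_ge0.
- exact: kernel_op_integrand.
- exact: kernel_op_integrand.
move=> s /EI sI; rewrite -mulrBl normrM ler_pM //; first exact: Gtt.
exact: uC.
Qed.

Lemma kernel_op_ge0 u t :
  (forall s, unitI s -> 0 <= G t s) -> (forall s, unitI s -> 0 <= u s) ->
  0 <= kernel_op u t.
Proof.
by move=> G0 u0; apply: Rintegral_ge0 => s /EI sI; rewrite mulr_ge0 ?G0 ?u0.
Qed.

Lemma kernel_op_le u t k : unitI t -> unit_cont u ->
  (forall s, unitI s -> 0 <= G t s) -> (forall s, E s -> u s <= k) ->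
  kernel_op u t <= (\int[mu]_(s in E) G t s) * k.
Proof.
move=> tI uc G0 uk; rewrite -unit_integral_scale //; last exact: kernel_unit_cont.
apply: le_unit_integral => //; first exact: kernel_op_integrand.
  by apply: unit_contM; [apply: kernel_unit_cont|apply: unit_cont_cst].
by move=> s Es; rewrite ler_wpM2l ?uk // G0 //; apply: EI.
Qed.

Lemma kernel_op_ge u t k : unitI t -> unit_cont u ->
  (forall s, unitI s -> 0 <= G t s) -> (forall s, E s -> k <= u s) ->
  (\int[mu]_(s in E) G t s) * k <= kernel_op u t.
Proof.
move=> tI uc G0 uk; rewrite -unit_integral_scale //; last exact: kernel_unit_cont.
apply: le_unit_integral => //; last first.
- by move=> s Es; rewrite ler_wpM2l ?uk // G0 //; apply: EI.
- exact: kernel_op_integrand.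
by apply: unit_contM; [apply: kernel_unit_cont|apply: unit_cont_cst].
Qed.

Lemma kernel_op_scale_le u t t' k : unitI t -> unitI t' -> unit_cont u ->
  (forall s, unitI s -> 0 <= u s) -> (forall s, unitI s -> k * G t' s <= G t s) ->
  k * kernel_op u t' <= kernel_op u t.
Proof.
move=> tI t'I uc u0 kG; rewrite mulrC -unit_integral_scale //; last exact: kernel_op_integrand.
apply: le_unit_integral => //.
- by apply: unit_contM; [apply: kernel_op_integrand|apply: unit_cont_cst].
- exact: kernel_op_integrand.
by move=> s /EI sI; rewrite mulrC mulrA ler_wpM2r ?u0 ?kG.
Qed.

End Kernel.

(** * The truncated system *)

Section Nonlinearity.
Context {R : realType}.
Variables (f : R -> R -> R -> R) (lo hi : 'I_2 -> R).
Hypothesis f_cont : {within unitI `*` `[0, +oo[ `*` `[0, +oo[,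
  continuous (fun p : R * R * R => f p.1.1 p.1.2 p.2)}.
Hypothesis f_ge0 : forall s (y1 y2 : R), unitI s -> 0 <= y1 -> 0 <= y2 -> 0 <= f s y1 y2.
Hypotheses (lo_ge0 : forall i, 0 <= lo i) (lo_le_hi : forall i, lo i <= hi i).

(** The truncations only take values in this compact part of the domain, where
    [f] is bounded and uniformly continuous. *)
Let slab : set (R * R * R) := unitI `*` `[0, hi 0] `*` `[0, hi 1].

Let slab_compact : compact slab.
Proof. by apply: compact_setX; [apply: compact_setX|]; apply: segment_compact. Qed.

Let slab_cont : {within slab, continuous (fun p : R * R * R => f p.1.1 p.1.2 p.2)}.
Proof.
apply: continuous_subspaceW f_cont => -[[s y] z] [[/= sI]] /=.
rewrite !in_itv /= !andbT => /andP[y0 _] /andP[z0 _].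
by rewrite y0 z0.
Qed.

Lemma nonlinearity_bounded : exists2 C : R, 0 < C &
  forall s y, unitI s -> box (fun=> 0) hi y -> `|f s (y 0) (y 1)| <= C.
Proof.
have [C C0 fC] := compact_continuous_bounded slab_compact slab_cont.
exists C => // s y sI yb; apply: (fC (s, y 0, y 1)).
by split; [split|] => //=; rewrite in_itv /= yb.
Qed.

Lemma nonlinearity_modulus e : 0 < e -> exists2 d : R, 0 < d &
  forall s s' y y', unitI s -> unitI s' -> box (fun=> 0) hi y -> box (fun=> 0) hi y' ->
    `|s - s'| <= d -> (forall i, `|y i - y' i| <= d) ->
    `|f s (y 0) (y 1) - f s' (y' 0) (y' 1)| <= e.
Proof.
move=> /(compact_uniformly_continuous slab_compact slab_cont)[d d0 dP].
have d20 : 0 < d / 2 by rewrite divr_gt0.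
exists (d / 2) => // s s' y y' sI s'I yb y'b ss' yy'.
apply: (dP (s, y 0, y 1) (s', y' 0, y' 1)).
- by split; [split|] => //=; rewrite in_itv /= yb.
- by split; [split|] => //=; rewrite in_itv /= y'b.
have lt2 : d / 2 < d by lra.
split; [split|]; rewrite /ball /=.
- exact: le_lt_trans ss' _.
- exact: le_lt_trans (yy' 0) _.
- exact: le_lt_trans (yy' 1) _.
Qed.

Definition truncation (x : 'I_2 -> R -> R) s i := clamp (lo i) (hi i) (x i s).

Definition truncated x s := f s (truncation x s 0) (truncation x s 1).

Lemma truncation_box x s : box lo hi (truncation x s).
Proof. by move=> i; rewrite /truncation clamp_ge clamp_le. Qed.

Lemma truncation_box0 x s : box (fun=> 0) hi (truncation x s).
Proof.
move=> i; have /andP[lt th] := truncation_box x s i.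
by rewrite th (le_trans (lo_ge0 i)).
Qed.

Lemma truncated_ge0 x s : unitI s -> 0 <= truncated x s.
Proof.
have x0 i : 0 <= truncation x s i by have /andP[] := truncation_box0 x s i.
by move=> sI; apply: f_ge0.
Qed.

Lemma truncated_unit_cont x : curve x -> unit_cont (truncated x).
Proof.
move=> xc; apply/subspace_continuousP => s sI.
apply/cvgrPdist_le => e /nonlinearity_modulus[d d0 dP].
have near_x i : \forall t \near (s : R^o), `|x i s - x i t| < d.
  by have /cvgrPdist_lt/(_ d d0) := xc i s.
have near_s : \forall t \near (s : R^o), `|s - t| < d by apply: (nbhsx_ballx (s : R^o) d d0).
have near_all : \forall t \near (s : R^o), forall i, `|x i s - x i t| < d.
  exact: filter_forall near_x.
rewrite near_withinE; apply: filterS (filterI near_s near_all) => t [/ltW st xt] tI.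
apply: (dP s t _ _ sI tI (truncation_box0 x s) (truncation_box0 x t) st) => i.
exact: le_trans (clamp_dist _ _ _ _) (ltW (xt i)).
Qed.

Lemma truncated_dist e : 0 < e -> exists2 d : R, 0 < d & forall x y,
  close_on_unit x y d -> forall s, unitI s -> `|truncated x s - truncated y s| <= e.
Proof.
move=> /nonlinearity_modulus[d d0 dP]; exists d => // x y xy s sI.
apply: (dP s s _ _ sI sI (truncation_box0 x s) (truncation_box0 y s)).
  by rewrite subrr normr0 ltW.
by move=> i; apply: le_trans (clamp_dist _ _ _ _) (xy i s sI).
Qed.

End Nonlinearity.

Lemma dist_add_half (R : realFieldType) (a a' b b' e : R) :
  `|a - a'| <= e / 2 -> `|b - b'| <= e / 2 -> `|a + b - (a' + b')| <= e.
Proof.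
move=> aa bb; rewrite opprD addrACA [e]splitr.
by apply: le_trans (ler_normD _ _) _; apply: lerD.
Qed.

Section TruncatedSystem.
Context {R : realType}.
Variables (G : 'I_2 -> R -> R -> R) (f : 'I_2 -> R -> R -> R -> R).
Variables (J : set R) (lo Rad : 'I_2 -> R).
Hypotheses (mJ : measurable (J : set (measurableTypeR R))) (JI : J `<=` unitI).
Hypothesis G_ge0 : forall j t s, unitI t -> unitI s -> 0 <= G j t s.
Hypothesis G_cont : forall j,
  {within unitI `*` unitI, continuous (fun p : R * R => G j p.1 p.2)}.
Hypothesis f_ge0 : forall j s (y1 y2 : R),
  unitI s -> 0 <= y1 -> 0 <= y2 -> 0 <= f j s y1 y2.
Hypothesis f_cont : forall j, {within unitI `*` `[0, +oo[ `*` `[0, +oo[,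
  continuous (fun p : R * R * R => f j p.1.1 p.1.2 p.2)}.
Hypotheses (lo_ge0 : forall i, 0 <= lo i) (lo_le_Rad : forall i, lo i <= Rad i).

(** Truncating from below by [lo] is only harmless on [J], where the cone gives
    lower bounds; this is why the integral is split. *)
Definition truncated_op (x : 'I_2 -> R -> R) j t :=
  kernel_op (G j) J (truncated (f j) lo Rad x) t +
  kernel_op (G j) (unitI `\` J) (truncated (f j) (fun=> 0) Rad x) t.

Lemma measurable_unitD : measurable (unitI `\` J : set (measurableTypeR R)).
Proof. by apply: measurableD => //; apply: measurable_unitI. Qed.

(** The hypotheses of [schauder_curves] hold because the truncated
    nonlinearities are uniformly bounded and depend uniformly continuously on
    the curve, while equicontinuity comes from the kernels. *)
Lemma truncated_op_fixed :
  exists2 x, curve x & forall j t, unitI t -> truncated_op x j t = x j t.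
Proof.
have mD := measurable_unitD; have DI : unitI `\` J `<=` unitI by apply: subDsetl.
have Rad_ge0 i : 0 <= Rad i by apply: le_trans (lo_le_Rad i).
have z_ge0 (i : 'I_2) : 0 <= 0 :> R by [].
(* the common bounds are written as inverses so that [uniform_radius] provides them *)
have [C C0 GC] : exists2 C : R, 0 < C & forall j t s, unitI t -> unitI s -> `|G j t s| <= C^-1.
  apply: uniform_radius => j; have [C C0 GC] := kernel_bounded (@G_cont j).
  exists C^-1; rewrite ?invr_gt0 // => d d0 dC t s tI sI.
  by apply: le_trans (GC t s tI sI) _; rewrite -[leLHS]invrK lef_pV2 ?posrE ?invr_gt0.
have [D D0 fD] : exists2 D : R, 0 < D & forall j s y, unitI s -> box (fun=> 0) Rad y ->
    `|f j s (y 0) (y 1)| <= D^-1.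
  apply: uniform_radius => j; have [D D0 fD] := nonlinearity_bounded Rad (@f_cont j).
  exists D^-1; rewrite ?invr_gt0 // => d d0 dD s y sI yb.
  by apply: le_trans (fD s y sI yb) _; rewrite -[leLHS]invrK lef_pV2 ?posrE ?invr_gt0.
have C0' : 0 < C^-1 by rewrite invr_gt0.
have D0' : 0 < D^-1 by rewrite invr_gt0.
have uc1 j x : curve x -> unit_cont (truncated (f j) lo Rad x).
  exact: truncated_unit_cont.
have uc2 j x : curve x -> unit_cont (truncated (f j) (fun=> 0) Rad x).
  exact: truncated_unit_cont.
have ub1 j x s : unitI s -> `|truncated (f j) lo Rad x s| <= D^-1.
  by move=> sI; apply: fD => //; apply: truncation_box0.
have ub2 j x s : unitI s -> `|truncated (f j) (fun=> 0) Rad x s| <= D^-1.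
  by move=> sI; apply: fD => //; apply: truncation_box0.
apply: (@schauder_curves R _ truncated_op (2 * (C^-1 * D^-1)) _ _ _ _ 0).
- by rewrite !mulr_gt0.
- move=> x xc j t tI; apply/andP; split.
    apply: addr_ge0; apply: kernel_op_ge0 => // s sI.
    - exact: G_ge0.
    - exact: (truncated_ge0 (@f_ge0 j)).
    - exact: G_ge0.
    - exact: (truncated_ge0 (@f_ge0 j)).
  have zop E : kernel_op (G j) E (fun=> 0) t = 0.
    rewrite /kernel_op; under eq_Rintegral do rewrite mulr0.
    by rewrite /Rintegral integral0.
  have h1 := kernel_op_dist (@G_cont j) mJ JI (GC j) (ltW C0') (ltW D0') (uc1 j x xc)
    (@unit_cont_cst _ 0) _ tI.
  have h2 := kernel_op_dist (@G_cont j) mD DI (GC j) (ltW C0') (ltW D0') (uc2 j x xc)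
    (@unit_cont_cst _ 0) _ tI.
  rewrite !zop !subr0 in h1 h2.
  have : `|kernel_op (G j) J (truncated (f j) lo Rad x) t| <= C^-1 * D^-1.
    by apply: h1 => s Es; rewrite subr0; apply/ub1/JI.
  have : `|kernel_op (G j) (unitI `\` J) (truncated (f j) (fun=> 0) Rad x) t| <= C^-1 * D^-1.
    by apply: h2 => s Es; rewrite subr0; apply/ub2/DI.
  rewrite /truncated_op !ler_norml => /andP[_ ?] /andP[_ ?].
  by rewrite mulr_natl mulr2n lerD.
- move=> e e0; have q0 : 0 < e / (2 * D^-1) by rewrite divr_gt0 ?mulr_gt0.
  have [d d0 Gd] : exists2 d : R, 0 < d & forall j t s t' s',
      unitI t -> unitI s -> unitI t' -> unitI s' ->
      `|t - t'| <= d -> `|s - s'| <= d -> `|G j t s - G j t' s'| <= e / (2 * D^-1).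
    apply: uniform_radius => j; have [d d0 Gd] := kernel_modulus (@G_cont j) q0.
    exists d => // d' _ d'd t s t' s' tI sI t'I s'I tt' ss'.
    by apply: Gd => //; [apply: le_trans tt' _|apply: le_trans ss' _].
  exists d => // x xc j t t' tI t'I tt'.
  have Gtt s : unitI s -> `|G j t s - G j t' s| <= e / (2 * D^-1).
    by move=> sI; apply: Gd => //; rewrite subrr normr0 ltW.
  have := kernel_op_modulus (@G_cont j) mJ JI (ub1 j x) (ltW D0') (ltW q0) (uc1 j x xc) tI t'I Gtt.
  have := kernel_op_modulus (@G_cont j) mD DI (ub2 j x) (ltW D0') (ltW q0) (uc2 j x xc) tI t'I Gtt.
  have -> : e / (2 * D^-1) * D^-1 = e / 2 by field; rewrite gt_eqF.
  by move=> h2 h1; apply: dist_add_half.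
move=> e e0; have q0 : 0 < e / (2 * C^-1) by rewrite divr_gt0 ?mulr_gt0.
have [d1 d10 fd1] : exists2 d : R, 0 < d & forall j x y, close_on_unit x y d ->
    forall s, unitI s -> `|truncated (f j) lo Rad x s - truncated (f j) lo Rad y s| <= e / (2 * C^-1).
  apply: uniform_radius => j; have [d d0 fd] := truncated_dist (@f_cont j) lo_ge0 lo_le_Rad q0.
  exists d => // d' _ d'd x y xy; apply: fd => i s sI.
  exact: le_trans (xy i s sI) d'd.
have [d2 d20 fd2] : exists2 d : R, 0 < d & forall j x y, close_on_unit x y d ->
    forall s, unitI s ->
      `|truncated (f j) (fun=> 0) Rad x s - truncated (f j) (fun=> 0) Rad y s|
        <= e / (2 * C^-1).
  apply: uniform_radius => j; have [d d0 fd] := truncated_dist (@f_cont j) z_ge0 Rad_ge0 q0.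
  exists d => // d' _ d'd x y xy; apply: fd => i s sI.
  exact: le_trans (xy i s sI) d'd.
exists (Num.min d1 d2); first by rewrite lt_min d10.
move=> x y xc yc xy j t tI.
have xy1 : close_on_unit x y d1.
  by move=> i s sI; apply: le_trans (xy i s sI) _; rewrite ge_min lexx.
have xy2 : close_on_unit x y d2.
  by move=> i s sI; apply: le_trans (xy i s sI) _; rewrite ge_min lexx orbT.
have := kernel_op_dist (@G_cont j) mJ JI (GC j) (ltW C0') (ltW q0) (uc1 j x xc)
    (uc1 j y yc) (fun s Es => fd1 j x y xy1 s (JI Es)) tI.
have := kernel_op_dist (@G_cont j) mD DI (GC j) (ltW C0') (ltW q0) (uc2 j x xc)
    (uc2 j y yc) (fun s Es => fd2 j x y xy2 s (DI s Es)) tI.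
have -> : C^-1 * (e / (2 * C^-1)) = e / 2 by field; rewrite gt_eqF.
by move=> h2 h1; apply: dist_add_half.
Qed.

End TruncatedSystem.

(** * A priori estimates in the cone *)

Section KernelMass.
Context {R : realType}.
Local Notation mu := (@lebesgue_measure R).

(** Excludes a degenerate interval [J]. *)
Lemma Rintegral_completed_set1 (Phi : R -> R) (a : R) :
  \int[completed_lebesgue_measure]_(s in [set a]) Phi s = 0.
Proof.
rewrite (@eq_Rintegral _ _ _ _ _ (fun=> Phi a)); last first.
  by move=> s; rewrite inE /= => ->.
have ma : measurable ([set a] : set (measurableTypeR R)) by exact: measurable_set1.
rewrite Rintegral_cst; last exact: sub_caratheodory.
by rewrite [X in fine X](lebesgue_measure_set1 a) mulr0.
Qed.

(** This makes [const_D] a genuine inverse.  Since the integral of [Phi] over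
    [J] is positive, [Phi s0 > 0] for some [s0] in [J], so that [G t s0] is at
    least [c * Phi s0] for all [t] in [J]; by uniform continuity half of this
    bound persists for [s] in an interval around [s0] that does not depend on
    [t]. *)
Lemma kernel_mass (a b : R) (J : set R) (G : R -> R -> R) (Phi : R -> R) (c : R) :
  J = `[a, b]%classic -> J `<=` unitI ->
  (forall t s, unitI t -> unitI s -> 0 <= G t s) ->
  {within unitI `*` unitI, continuous (fun p : R * R => G p.1 p.2)} ->
  0 < c -> kernel_bound J G Phi c ->
  exists2 q : R, 0 < q & forall t, J t -> q <= \int[mu]_(s in J) G t s.
Proof.
move=> JE JI G0 Gc c0 [Phi0 _ intPhi _ cG].
have [s0 Js0 Phis0] : exists2 s0, J s0 & 0 < Phi s0.
  apply: contrapT => noPhi; move: intPhi.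
  rewrite /Rintegral integral0_eq ?ltxx // => s Js; congr EFin.
  apply/eqP; rewrite eq_le Phi0 ?andbT; last exact: JI.
  by rewrite leNgt; apply/negP => Phis; apply: noPhi; exists s.
have /andP[as0 s0b] : a <= s0 <= b by move: Js0; rewrite JE /= in_itv.
have ltab : a < b.
  rewrite lt_neqAle (le_trans as0 s0b) andbT; apply/eqP => eqab.
  by move: intPhi; rewrite JE -eqab set_itv1 Rintegral_completed_set1 ltxx.
pose h := c * Phi s0 / 2; have h0 : 0 < h by rewrite divr_gt0 // mulr_gt0.
have [d d0 Gd] := kernel_modulus Gc h0.
pose p := Num.max a (s0 - d); pose q := Num.min b (s0 + d).
have ltpq : p < q.
  by rewrite gt_max !lt_min ltab; apply/and3P; split; [lra|lra|lra].
have pqJ : `[p, q] `<=` J.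
  move=> s; rewrite JE /= !in_itv /= ge_max le_min.
  by move=> /andP[/andP[-> _] /andP[-> _]].
exists (h * (q - p)); first by rewrite mulr_gt0 // subr_gt0.
move=> t Jt; have mpq : measurable (`[p, q]%classic : set (measurableTypeR R)) by exact: measurable_itv.
have mJ : measurable (J : set (measurableTypeR R)) by rewrite JE; exact: measurable_itv.
have tI := JI t Jt; have Gtc := kernel_unit_cont Gc tI.
have JU : J = `[p, q]%classic `|` (J `\` `[p, q]%classic) by rewrite setDUK.
rewrite JU Rintegral_setU //; first last.
- by apply/disj_set2P; rewrite setDE setICA setICr setI0.
- by rewrite -JU; apply: unit_cont_integrable.
- exact: measurableD.
apply: (@le_trans _ _ (\int[mu]_(s in `[p, q]) G t s)); last first.
  rewrite lerDl; apply: Rintegral_ge0 => s [Js _]; apply: G0 => //.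
  exact: JI.
apply: (@le_trans _ _ (\int[mu]_(s in `[p, q]) h)).
  have mupq : mu (`[p, q]%classic : set R) = (q - p)%:E.
    by rewrite lebesgue_measure_itv /= lte_fin ltpq EFinB.
  by rewrite (Rintegral_cst mu mpq) [X in fine X]mupq.
apply: le_unit_integral => //.
- exact: subset_trans pqJ JI.
- exact: unit_cont_cst.
move=> s pqs; have sI := JI _ (pqJ _ pqs).
have s0I := JI _ Js0.
have := cG t s0 Jt s0I.
have : `|G t s0 - G t s| <= h.
  apply: Gd => //; first by rewrite subrr normr0 ltW.
  move: pqs; rewrite /= in_itv /= ge_max le_min ler_norml.
  by move=> /andP[/andP[_ ?] /andP[_ ?]]; apply/andP; split; lra.
by rewrite ler_norml /h => /andP[_ ?] ?; lra.
Qed.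

End KernelMass.

Section Suprema.
Context {R : realType}.
Local Notation mu := (@lebesgue_measure R).

Lemma norm_inf_ge (x : R -> R) t : unit_cont x -> unitI t -> `|x t| <= norm_inf x.
Proof.
move=> xc tI; have [C _ xC] := compact_continuous_bounded (@segment_compact R 0 1) xc.
apply: ub_le_sup; last by exists t.
by exists C => _ [s sI <-]; apply: xC.
Qed.

Lemma norm_inf_le (x : R -> R) k : (forall t, unitI t -> `|x t| <= k) -> norm_inf x <= k.
Proof.
move=> xk; apply: ge_sup; last by move=> _ [t tI <-]; apply: xk.
by exists `|x 0|, 0 => //; rewrite /unitI /= in_itv /= lexx ler01.
Qed.

Lemma kernel_integral_le_sup (G : R -> R -> R) (E : set R) t :
  {within unitI `*` unitI, continuous (fun p : R * R => G p.1 p.2)} ->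
  measurable (E : set (measurableTypeR R)) -> E `<=` unitI -> unitI t ->
  \int[mu]_(s in E) G t s <= sup [set \int[mu]_(s in E) G t s | t in unitI].
Proof.
move=> Gc mE EI tI; have [C C0 GC] := kernel_bounded Gc.
apply: ub_le_sup; last by exists t.
exists C => _ [s sI <-].
have := le_unit_integral_shift mE EI (ltW C0) (kernel_unit_cont Gc sI) (@unit_cont_cst _ 0).
rewrite [X in _ -> _ <= X + _]/Rintegral integral0 /= add0r; apply=> v Ev.
by rewrite (le_trans (ler_norm _)) // GC //; apply: EI.
Qed.

Variable f : 'I_2 -> R -> R -> R -> R.
Hypothesis f_cont : forall j, {within unitI `*` `[0, +oo[ `*` `[0, +oo[,
  continuous (fun p : R * R * R => f j p.1.1 p.1.2 p.2)}.

Lemma box_le_sup (lo hi y : 'I_2 -> R) j s : (forall i, 0 <= lo i) ->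
  unitI s -> box lo hi y ->
  f j s (y 0) (y 1) <= sup [set f j s (y 0) (y 1) | y in box lo hi].
Proof.
move=> lo0 sI yb; have [C _ fC] := nonlinearity_bounded hi (@f_cont j).
apply: ub_le_sup; last by exists y.
exists C => _ [z zb <-]; apply: le_trans (ler_norm _) _; apply: fC => // i.
by have /andP[? ->] := zb i; rewrite andbT (le_trans (lo0 i)).
Qed.

Lemma inf_le_box (lo hi y : 'I_2 -> R) j s : (forall i, 0 <= lo i) ->
  unitI s -> box lo hi y ->
  inf [set f j s (y 0) (y 1) | y in box lo hi] <= f j s (y 0) (y 1).
Proof.
move=> lo0 sI yb; have [C _ fC] := nonlinearity_bounded hi (@f_cont j).
apply: ge_inf; last by exists y.
exists (- C) => _ [z zb <-]; rewrite lerNl; apply: le_trans (ler_norm _) _.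
rewrite normrN; apply: fC => // i.
by have /andP[? ->] := zb i; rewrite andbT (le_trans (lo0 i)).
Qed.

End Suprema.

(** Here [m] and [n] stand for the minimum over [J] and the norm of an element
    of the cone, and [2^-1 * (m + n)] is its image under [phi]. *)
Section ConeArithmetic.
Context {R : realFieldType}.
Implicit Types c m n r y : R.

Lemma cone_mean_le c m n r : 0 < c -> c * n <= m -> 2^-1 * (m + n) <= r ->
  n <= 2 / (c + 1) * r.
Proof.
move=> c0 cnm mean; rewrite mulrAC ler_pdivlMr ?addr_gt0 // mulrDr mulr1.
by move: mean; rewrite mulrC ler_pdivrMr // => mean; rewrite [n * c]mulrC; lra.
Qed.

Lemma cone_mean_gt c m n r y : 0 < c -> c * n <= y -> m <= y ->
  r < 2^-1 * (m + n) -> 2 * c / (c + 1) * r <= y.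
Proof.
move=> c0 cny my mean; rewrite mulrAC ler_pdivrMr ?addr_gt0 //.
have : c * (2 * r) <= c * (m + n) by rewrite ler_pM2l //; lra.
have : c * m <= c * y by rewrite ler_pM2l.
by rewrite !mulrDr mulr1 [y * c]mulrC mulrA [c * 2]mulrC; lra.
Qed.

Lemma mean_gt m n r : r < m -> m <= n -> r < 2^-1 * (m + n).
Proof. by move=> rm mn; lra. Qed.

End ConeArithmetic.

Theorem theorem5p4 (R : realType)
    (a b : R) (J : set R)
    (G : 'I_2 -> R -> R -> R) (Phi : 'I_2 -> R -> R) (c : 'I_2 -> R)
    (f : 'I_2 -> R -> R -> R -> R)
    (r Rad A B : 'I_2 -> R)
    (J_itv : J = `[a, b]%classic) (J_sub : J `<=` unitI)
    (G_ge0 : forall j t s, unitI t -> unitI s -> 0 <= G j t s)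
    (G_cont : forall j,
      {within unitI `*` unitI, continuous (fun p : R * R => G j p.1 p.2)})
    (c_gt0_lt1 : forall j, 0 < c j < 1)
    (G_bound : forall j, kernel_bound J (G j) (Phi j) (c j))
    (f_ge0 : forall j s y1 y2,
      unitI s -> 0 <= y1 -> 0 <= y2 -> 0 <= f j s y1 y2)
    (f_cont : forall j,
      {within unitI `*` `[0, +oo[ `*` `[0, +oo[,
        continuous (fun p : R * R * R => f j p.1.1 p.1.2 p.2)})
    (r_gt0 : forall j, 0 < r j) (Rad_gt0 : forall j, 0 < Rad j)
    (A_gt0 : forall j, 0 < A j) (B_gt0 : forall j, 0 < B j)
    (r_lt_Rad : forall j, 2 / (c j + 1) * r j < Rad j)
    (B_le_d_le_A : forall j, B j <= const_d (G j) <= A j)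
    (BS_AS : forall j,
      B j * const_S J (G j) + A j * const_Sc J (G j) < 1)
    (condA_Jc : forall j s, (unitI `\` J) s ->
      0 <= M_R f Rad j s <= A j * Rad j)
    (condA_J : forall j s, J s ->
      0 <= M_rR f c r Rad j s <= B j * Rad j)
    (condB : forall j s, J s -> m_rR f c r Rad j s > const_D J (G j) * r j) :
  exists x : 'I_2 -> R -> R,
    [/\ positive_solution G f x,
        cone_prod J c x,
        forall j, phi J (x j) > r j &
        forall j, norm_inf (x j) < Rad j].
Proof.
pose lo i := 2 * c i / (c i + 1) * r i.
pose hi i := 2 / (c i + 1) * r i.
have c0 i : 0 < c i by have /andP[] := c_gt0_lt1 i.
have c1 i : c i < 1 by have /andP[] := c_gt0_lt1 i.
have hi0 i : 0 < hi i by rewrite mulr_gt0 // divr_gt0 // addr_gt0.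
have loE i : lo i = c i * hi i by rewrite /lo /hi; ring.
have lo_ge0 i : 0 <= lo i by rewrite loE mulr_ge0 // ltW.
have lo_le_hi i : lo i <= hi i by rewrite loE ler_piMl // ltW.
have lo_le_Rad i : lo i <= Rad i by apply: le_trans (lo_le_hi i) (ltW (r_lt_Rad i)).
have z_ge0 (i : 'I_2) : 0 <= 0 :> R by [].
have Rad_ge0 i : 0 <= Rad i by apply: ltW.
have mJ : measurable (J : set (measurableTypeR R)) by rewrite J_itv; exact: measurable_itv.
have mD := measurable_unitD mJ; have DI : unitI `\` J `<=` unitI by apply: subDsetl.
have [x xc xfix] := truncated_op_fixed mJ J_sub G_ge0 G_cont f_ge0 f_cont lo_ge0 lo_le_Rad.
pose u1 j := truncated (f j) lo Rad x; pose u2 j := truncated (f j) (fun=> 0) Rad x.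
have u1c j : unit_cont (u1 j) by apply: truncated_unit_cont.
have u2c j : unit_cont (u2 j) by apply: truncated_unit_cont.
have u1_ge0 j s : unitI s -> 0 <= u1 j s by apply: (truncated_ge0 (f_ge0 j)).
have u2_ge0 j s : unitI s -> 0 <= u2 j s by apply: (truncated_ge0 (f_ge0 j)).
have xuc j : unit_cont (x j) by apply: continuous_subspaceT; apply: xc.
have xE j t : unitI t ->
    x j t = kernel_op (G j) J (u1 j) t + kernel_op (G j) (unitI `\` J) (u2 j) t.
  by move=> tI; rewrite -xfix.
have op1_ge0 j t : unitI t -> 0 <= kernel_op (G j) J (u1 j) t.
  by move=> tI; apply: kernel_op_ge0 => // s sI; [apply: G_ge0|apply: u1_ge0].
have op2_ge0 j t : unitI t -> 0 <= kernel_op (G j) (unitI `\` J) (u2 j) t.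
  by move=> tI; apply: kernel_op_ge0 => // s sI; [apply: G_ge0|apply: u2_ge0].
have x_ge0 j t : unitI t -> 0 <= x j t.
  by move=> tI; rewrite xE // addr_ge0 ?op1_ge0 ?op2_ge0.
have x_le_norm j t : unitI t -> x j t <= norm_inf (x j).
  by move=> tI; apply: le_trans (ler_norm _) (norm_inf_ge (xuc j) tI).
have x_cone j t : J t -> c j * norm_inf (x j) <= x j t.
  move=> Jt; rewrite mulrC -ler_pdivlMr //; apply: norm_inf_le => t' t'I.
  rewrite ger0_norm ?x_ge0 // ler_pdivlMr // mulrC.
  have tI := J_sub _ Jt; have [_ _ _ GPhi PhiG] := G_bound j.
  (* [Phi j] bounds one kernel value from above and the other from below *)
  have cG s : unitI s -> c j * G j t' s <= G j t s.
    move=> sI; apply: le_trans (PhiG t s Jt sI); rewrite ler_pM2l //.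
    exact: GPhi.
  rewrite !xE // mulrDr; apply: lerD; apply: (kernel_op_scale_le (G_cont j)) => //.
  - exact: u1_ge0.
  - exact: u2_ge0.
have norm_lt j : norm_inf (x j) < Rad j.
  rewrite ltNge; apply/negP => Rad_le.
  have u1B s : J s -> u1 j s <= B j * Rad j.
    move=> Js; have /andP[_] := condA_J j s Js; apply: le_trans.
    apply: (box_le_sup f_cont (y := truncation lo Rad x s)) => //.
    - by move=> i; case: ifP => _; rewrite ?lo_ge0 // mulr_ge0 // ltW.
    - exact: J_sub.
    move=> i; have := truncation_box lo_le_Rad x s i.
    case: eqP => [->|_] // /andP[_ ->]; rewrite andbT /truncation /clamp.
    rewrite le_max le_min; apply/orP; right; apply/andP; split.
      by rewrite ler_piMl // ltW.
    by apply: le_trans (x_cone j s Js); rewrite ler_pM2l.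
  have u2A s : (unitI `\` J) s -> u2 j s <= A j * Rad j.
    move=> Ds; have /andP[_] := condA_Jc j s Ds; apply: le_trans.
    apply: (box_le_sup f_cont (y := truncation (fun=> 0) Rad x s)) => //.
      exact: DI.
    exact: truncation_box.
  have : norm_inf (x j) <= (B j * const_S J (G j) + A j * const_Sc J (G j)) * Rad j.
    apply: norm_inf_le => t tI; rewrite ger0_norm ?x_ge0 // xE // mulrDl.
    apply: lerD.
      apply: le_trans (kernel_op_le (G_cont j) mJ J_sub tI (u1c j) _ u1B) _.
        by move=> s sI; apply: G_ge0.
      have -> : B j * const_S J (G j) * Rad j = const_S J (G j) * (B j * Rad j) by ring.
      apply: ler_wpM2r; first by apply: mulr_ge0; exact: ltW.
      exact: (kernel_integral_le_sup (G_cont j) mJ J_sub tI).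
    apply: le_trans (kernel_op_le (G_cont j) mD DI tI (u2c j) _ u2A) _.
      by move=> s sI; apply: G_ge0.
    have -> : A j * const_Sc J (G j) * Rad j = const_Sc J (G j) * (A j * Rad j) by ring.
    apply: ler_wpM2r; first by apply: mulr_ge0; exact: ltW.
    exact: (kernel_integral_le_sup (G_cont j) mD DI tI).
  apply/negP; rewrite -ltNge; apply: lt_le_trans Rad_le.
  by rewrite gtr_pMl.
have [s0 Js0] : J !=set0.
  apply/set0P; apply/eqP => J0; have [_ _ + _ _] := G_bound 0.
  by rewrite J0 Rintegral_set0 ltxx.
have le_ab : a <= b.
  by move: Js0; rewrite J_itv /= in_itv /= => /andP[]; apply: le_trans.
have inf_x_le j t : J t -> inf [set x j t | t in J] <= x j t.
  move=> Jt; apply: ge_inf; last by exists t.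
  by exists 0 => _ [s Js <-]; apply/x_ge0/J_sub.
have inf_x_ge j k : (forall t, J t -> k <= x j t) -> k <= inf [set x j t | t in J].
  move=> kx; apply: lb_le_inf; first by exists (x j s0), s0.
  by move=> _ [t Jt <-]; apply: kx.
have inf_x_le_norm j : inf [set x j t | t in J] <= norm_inf (x j).
  by apply: le_trans (inf_x_le j s0 Js0) (x_le_norm j s0 (J_sub _ Js0)).
have phi_gt j : r j < phi J (x j).
  rewrite ltNge; apply/negP => phi_le.
  have norm_le : norm_inf (x j) <= hi j.
    exact: cone_mean_le (c0 j) (inf_x_ge j _ (x_cone j)) phi_le.
  have u1m s : J s -> m_rR f c r Rad j s <= u1 j s.
    move=> Js; apply: (inf_le_box f_cont (y := truncation lo Rad x s)) => //.
      exact: J_sub.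
    move=> i; have := truncation_box lo_le_Rad x s i.
    case: eqP => [->|_] // /andP[-> _] /=.
    rewrite /truncation /clamp ge_max lo_le_hi ge_min /=.
    by rewrite (le_trans (x_le_norm j s (J_sub _ Js))) ?orbT.
  (* the minimum of [u1 j] over [J] keeps (B) strict under the integral *)
  have u1cJ : {within `[a, b], continuous (u1 j)}.
    by apply: continuous_subspaceW (u1c j); rewrite -J_itv.
  have [s1 s1ab s1min] := EVT_min le_ab u1cJ.
  have Js1 : J s1 by rewrite J_itv.
  have [q q0 qG] := kernel_mass J_itv J_sub (G_ge0 j) (G_cont j) (c0 j) (G_bound j).
  pose I := inf [set \int[lebesgue_measure]_(s in J) G j t s | t in J].
  have I0 : 0 < I.
    apply: lt_le_trans q0 _; apply: lb_le_inf; last by move=> _ [t Jt <-]; apply: qG.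
    by exists (\int[lebesgue_measure]_(s in J) G j s0 s), s0.
  have rIu : r j < I * u1 j s1.
    have := lt_le_trans (condB j s1 Js1) (u1m s1 Js1).
    by rewrite /const_D -/I ltr_pdivrMl.
  have inf_gt : r j < inf [set x j t | t in J].
    apply: lt_le_trans rIu _; apply: inf_x_ge => t Jt; have tI := J_sub _ Jt.
    rewrite xE //; apply: le_trans (_ : kernel_op (G j) J (u1 j) t <= _); last first.
      by rewrite lerDl op2_ge0.
    apply: le_trans (kernel_op_ge (k := u1 j s1) (G_cont j) mJ J_sub tI (u1c j) _ _).
    - rewrite ler_wpM2r ?u1_ge0 //; first exact: J_sub.
      apply: ge_inf; last by exists t.
      by exists 0 => _ [s Js <-]; apply: ltW; apply: lt_le_trans (qG s Js).
    - by move=> s sI; apply: G_ge0.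
    by move=> s Js; apply: s1min; move: Js; rewrite J_itv.
  by move: phi_le; rewrite leNgt => /negP; apply; apply: mean_gt.
have x_ge_lo j s : J s -> lo j <= x j s.
  by move=> Js; apply: cone_mean_gt (c0 j) (x_cone j s Js) (inf_x_le j s Js) (phi_gt j).
have fE2 j s : unitI s -> f j s (x 0 s) (x 1 s) = u2 j s.
  move=> sI; rewrite /u2 /truncated /truncation !clamp_id // x_ge0 //=.
    exact: le_trans (x_le_norm 1 s sI) (ltW (norm_lt 1)).
  exact: le_trans (x_le_norm 0 s sI) (ltW (norm_lt 0)).
have fE1 j s : J s -> f j s (x 0 s) (x 1 s) = u1 j s.
  move=> Js; have sI := J_sub _ Js.
  rewrite /u1 /truncated /truncation !clamp_id // x_ge_lo //=.
    exact: le_trans (x_le_norm 1 s sI) (ltW (norm_lt 1)).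
  exact: le_trans (x_le_norm 0 s sI) (ltW (norm_lt 0)).
exists x; split=> //; move=> j; split.
- exact: xuc.
- exact: x_ge0.
- exists s0; first exact: J_sub.
  by rewrite gt_eqF // (lt_le_trans _ (x_ge_lo j s0 Js0)) // loE mulr_gt0.
- move=> t tI; rewrite xE //; transitivity (kernel_op (G j) unitI (u2 j) t); last first.
    by apply: eq_Rintegral => s; rewrite inE => sI; rewrite fE2.
  have IU : unitI = J `|` (unitI `\` J) by rewrite setDUK.
  rewrite [in RHS]/kernel_op [in RHS]IU Rintegral_setU //; first last.
  + by apply/disj_set2P; rewrite setDE setICA setICr setI0.
  + rewrite -IU; apply: (unit_cont_integrable (@measurable_unitI R)) => //.
    exact: kernel_op_integrand.
  congr (_ + _); apply: eq_Rintegral => s; rewrite inE => Js.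
  by rewrite -fE1 // fE2 //; apply: J_sub.
- exact: xuc.
- exact: x_ge0.
- exact: x_cone.
Qed.
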